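(* Let $(S_n)_{n\ge0}$ be a real-valued random walk of oscillating type with $S_0=0$. Let $\mu$ and $\hat\mu$ be the renewal measures of (the absolute values of) its strictly descending and strictly ascending ladder heights, respectively, and let $c^=\in(0,\infty)$ be the constant $c^==\exp\big(\sum_{n=1}^\infty\frac1n\mathbb P(S_n=0)\big)$. For measurable $f:\mathbb R_+\to\mathbb R_+$ define the Green operators $$Gf(x)=\sum_{n=0}^\infty\mathbb E\big[f(x+S_n)\mathbf 1_{\{x+S_k\ge0,\ 1\le k\le n\}}\big],\qquad \bar Gf(x)=\sum_{n=0}^\infty\mathbb E\big[f(x+S_n)\mathbf 1_{\{x+S_k>0,\ 1\le k\le n\}}\big].$$ Then for every measurable, non-negative function $f:\mathbb R_+\to\mathbb R_+$, $$Gf(x)=c^=\int_{[0,x]\times[0,\infty)}(\mu\otimes\hat\mu)(dy,dz)\,f(x-y+z)\qquad\text{for all }x\ge0,$$ $$\bar Gf(x)=c^=\int_{[0,x)\times[0,\infty)}(\mu\otimes\hat\mu)(dy,dz)\,f(x-y+z)\qquad\text{for all }x>0.$$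
   Context: A random walk ($S_n$ = sum of $n$ i.i.d. real increments) is of oscillating type if almost surely $\limsup_n S_n=+\infty$ and $\liminf_nS_n=-\infty$. Strictly descending ladder times and heights: $L_0=0$, $L_{n+1}=\min\{k>L_n:S_k<S_{L_n}\}$, $H_n=S_{L_n}$. Strictly ascending ladder times and heights: $\hat L_0=0$, $\hat L_{n+1}=\min\{k>\hat L_n:S_k>S_{\hat L_n}\}$, $\hat H_n=S_{\hat L_n}$. The renewal measures are the measures on $[0,\infty)$ given by $\mu(dx)=\sum_{n\ge0}\mathbb P(|H_n|\in dx)$ and $\hat\mu(dx)=\sum_{n\ge0}\mathbb P(\hat H_n\in dx)$ (both have an atom of mass at least $1$ at $0$ coming from $n=0$). All quantities take values in $[0,\infty]$. *)

(* Defs.v *)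
From HB Require Import structures.
From mathcomp Require Import all_boot all_order all_algebra.
From mathcomp Require Import all_classical all_reals all_analysis.
From mathcomp Require Import measurable_realfun.

Set Implicit Arguments.
Unset Strict Implicit.
Unset Printing Implicit Defensive.

Import Order.TTheory GRing.Theory Num.Theory.
Import numFieldNormedType.Exports.

Local Open Scope classical_set_scope.
Local Open Scope ring_scope.

Section ladder.
Context {R : realType}.
Implicit Types (r : rel R) (s : nat -> R).

(* [r (s k) (s m)] says that the value at time [k] is a record relative to
   time [m]; [None] stands for the minimum of the empty set, that is, an
   infinite ladder time. *)
Definition next_ladder r s (m : nat) : option nat :=
  match pselect (exists k, (m < k)%N && r (s k) (s m)) with
  | left ex => Some (ex_minn ex)
  | right _ => None
  end.

Fixpoint ladder_time r s (n : nat) : option nat :=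
  if n is n'.+1 then obind (next_ladder r s) (ladder_time r s n') else Some 0%N.

Definition ladder_height r s (n : nat) : option R := omap s (ladder_time r s n).

Definition desc_height s := ladder_height (fun u v => u < v) s.
Definition asc_height s := ladder_height (fun u v => v < u) s.

Lemma next_ladderE r s m k : next_ladder r s m = Some k <->
  [/\ (m < k)%N, r (s k) (s m) &
      forall j, (m < j < k)%N -> ~~ r (s j) (s m)].
Proof.
rewrite /next_ladder; case: pselect => [ex|nex]; last first.
  by split=> // -[mk rk _]; case: nex; exists k; rewrite mk.
case: ex_minnP => k0 /andP[mk0 rk0] mink0; split=> [[<-]|[mk rk nrj]].
  split=> // j /andP[mj jk0]; apply/negP => rj.
  by have := mink0 j; rewrite mj rj leqNgt jk0 => /(_ isT).
congr Some; apply/eqP; rewrite eqn_leq mink0 ?mk//= leqNgt; apply/negP => k0k.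
by have := nrj k0; rewrite mk0 k0k rk0 => /(_ isT).
Qed.

End ladder.

Section random_walk.
Context d {T : measurableType d} {R : realType} (P : probability T R).
Local Open Scope ereal_scope.

Definition independent_RVs (X : nat -> {RV P >-> R}) :=
  forall (I : seq nat) (A : nat -> set R), uniq I ->
    (forall i, measurable (A i)) ->
    P (\bigcap_(i in [set` I]) (X i @^-1` A i)) =
    \prod_(i <- I) P (X i @^-1` A i).

Definition identically_distributed (X : nat -> {RV P >-> R}) :=
  forall i (A : set R), measurable A ->
    distribution P (X i) A = distribution P (X 0%N) A.

Definition iid (X : nat -> {RV P >-> R}) :=
  independent_RVs X /\ identically_distributed X.

Definition walk (X : nat -> {RV P >-> R}) (n : nat) (w : T) : R :=
  (\sum_(i < n) X i w)%R.

Definition oscillating (X : nat -> {RV P >-> R}) :=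
  {ae P, forall w, limn_esup (fun n => (walk X n w)%:E) = +oo /\
                   limn_einf (fun n => (walk X n w)%:E) = -oo}.

(* The event [H \in A] for a partially defined [H]; undefined values do not
   contribute. *)
Definition value_event (H : T -> option R) (A : set R) : set T :=
  [set w | exists2 h, H w = Some h & A h].

(* The renewal measures live on [0, +oo[ and are encoded as measures on R that
   do not charge the negative half-line. *)
Definition desc_renewal (X : nat -> {RV P >-> R}) (A : set R) : \bar R :=
  \sum_(0 <= n <oo)
    P (value_event (fun w => omap Num.norm (desc_height (walk X ^~ w) n)) A).

Definition asc_renewal (X : nat -> {RV P >-> R}) (A : set R) : \bar R :=
  \sum_(0 <= n <oo) P (value_event (fun w => asc_height (walk X ^~ w) n) A).

Definition c_eq (X : nat -> {RV P >-> R}) : \bar R :=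
  expeR (\sum_(1 <= n <oo) (n%:R^-1)%:E * P [set w | walk X n w = 0%R]).

Definition green (X : nat -> {RV P >-> R}) (f : R -> R) (x : R) : \bar R :=
  \sum_(0 <= n <oo) 'E_P[fun w => (f (x + walk X n w) *
    \1_[set w | forall k, (1 <= k <= n)%N -> 0 <= x + walk X k w] w)%R].

Definition green_bar (X : nat -> {RV P >-> R}) (f : R -> R) (x : R) : \bar R :=
  \sum_(0 <= n <oo) 'E_P[fun w => (f (x + walk X n w) *
    \1_[set w | forall k, (1 <= k <= n)%N -> 0 < x + walk X k w] w)%R].

End random_walk.

Section renewal_is_measure.
Context d {T : measurableType d} {R : realType} {P : probability T R}.
Local Open Scope ereal_scope.

Section value_law_measure.
Variable H : T -> option R.
Hypothesis mH : forall A : set R, measurable A -> measurable (value_event H A).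

(* As with [mrestr], the measurability proof is an argument so that the measure
   structure below can be inferred. *)
Definition value_law of
    (forall A : set R, measurable A -> measurable (value_event H A)) :=
  fun A : set R => P (value_event H A).

Local Notation nu := (value_law mH).

Let nu0 : nu set0 = 0.
Proof.
by rewrite /value_law (_ : value_event _ _ = set0) ?measure0//;
  apply/seteqP; split=> // w [].
Qed.

Let nu_ge0 A : 0 <= nu A. Proof. exact: measure_ge0. Qed.

Let nu_sigma_additive : semi_sigma_additive nu.
Proof.
move=> F mF tF mUF; rewrite /value_law.
rewrite (_ : value_event H _ = \bigcup_n value_event H (F n)); last first.
  apply/seteqP; split=> w.
    by move=> [h Hh [n _ Fh]]; exists n => //; exists h.
  by move=> [n _ [h Hh Fh]]; exists h => //; exists n.
apply: measure_semi_sigma_additive.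
- by move=> n; exact: mH.
- move=> i j _ _ [w [[h Hh Fi] [h' Hh' Fj]]].
  apply: tF => //; exists h; split=> //.
  by move: Hh'; rewrite Hh => -[->].
- by apply: bigcup_measurable => n _; exact: mH.
Qed.

HB.instance Definition _ := isMeasure.Build _ _ _ nu
  nu0 nu_ge0 nu_sigma_additive.

End value_law_measure.

Variable X : nat -> {RV P >-> R}.

Lemma measurable_walk n : measurable_fun setT (walk X n).
Proof. by apply: measurable_sum => i; exact: measurable_funP. Qed.

Lemma measurable_ladder_time (r : rel R)
    (mr : forall k m, measurable [set w | r (walk X k w) (walk X m w)]) n k :
  measurable [set w | ladder_time r (walk X ^~ w) n = Some k].
Proof.
elim: n k => [|n IH] k /=.
  have [->|k0] := eqVneq k 0%N.
    by rewrite (_ : [set w | _] = setT)//; apply/seteqP; split.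
  rewrite (_ : [set w | _] = set0)//; apply/seteqP; split=> // w /= [] k0'.
  by rewrite -k0' eqxx in k0.
rewrite (_ : [set w | _] = \bigcup_m
  ([set w | ladder_time r (walk X ^~ w) n = Some m] `&`
   ([set _ | (m < k)%N] `&` [set w | r (walk X k w) (walk X m w)] `&`
    \bigcap_(j in [set j | (m < j < k)%N])
      ~` [set w | r (walk X j w) (walk X m w)]))).
  apply: bigcup_measurable => m _; apply: measurableI; first exact: IH.
  apply: measurableI; last first.
    by apply: bigcap_measurableType => j _; apply: measurableC; exact: mr.
  apply: measurableI; last exact: mr.
  have [->|->] : [set w : T | (m < k)%N] = setT \/
      [set w : T | (m < k)%N] = set0.
  - by case: (m < k)%N; [left|right]; apply/seteqP; split.
  - exact: measurableT.
  - exact: measurable0.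
apply/seteqP; split=> w /=.
  case E : ladder_time => [m|//] /= /next_ladderE[mk rk nr].
  by exists m => //; split=> //; split=> // j /nr /negP.
move=> [m _ [-> [[mk rk] nr]]] /=; apply/next_ladderE; split=> // j /nr.
by move/negP.
Qed.

Lemma measurable_ladder_event (r : rel R)
    (mr : forall k m, measurable [set w | r (walk X k w) (walk X m w)])
    n (A : set R) : measurable A ->
  measurable (value_event (fun w => ladder_height r (walk X ^~ w) n) A).
Proof.
move=> mA; rewrite (_ : value_event _ _ = \bigcup_k
  ([set w | ladder_time r (walk X ^~ w) n = Some k] `&`
   (walk X k @^-1` A))).
  apply: bigcup_measurable => k _; apply: measurableI.
    exact: measurable_ladder_time.
  rewrite -[X in measurable X]setTI; exact: measurable_walk.
apply/seteqP; split=> w /=.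
  rewrite /value_event/= /ladder_height.
  by case E : (ladder_time _ _ _) => [k|] [h] //= [<-] Ah; exists k.
by move=> [k _ [E Ah]]; exists (walk X k w); rewrite // /ladder_height E.
Qed.

Lemma measurable_desc_event n (A : set R) : measurable A ->
  measurable
    (value_event (fun w => omap Num.norm (desc_height (walk X ^~ w) n)) A).
Proof.
move=> mA; rewrite (_ : value_event _ _ =
    value_event (fun w => desc_height (walk X ^~ w) n) (Num.norm @^-1` A)).
  apply: measurable_ladder_event => [k m|].
    rewrite -[X in measurable X]setTI.
    by apply: (measurable_fun_ltr (measurable_walk k) (measurable_walk m));
      rewrite //; exact: (_ : measurable [set true]).
  by rewrite -[X in measurable X]setTI; exact: (@normr_measurable R setT).
apply/seteqP; split=> w; rewrite /value_event /=.
  by case E : (desc_height _ _) => [h|] [h'] //= [<-] Ah; exists h.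
by move=> [h -> Ah]; exists `|h|%R.
Qed.

Lemma measurable_asc_event n (A : set R) : measurable A ->
  measurable (value_event (fun w => asc_height (walk X ^~ w) n) A).
Proof.
apply: measurable_ladder_event => k m; rewrite -[X in measurable X]setTI.
by apply: (measurable_fun_ltr (measurable_walk m) (measurable_walk k)) => //;
  exact: (_ : measurable [set true]).
Qed.

Let desc_mseries : {measure set R -> \bar R} :=
  mseries (fun n => value_law (measurable_desc_event n)) 0.
Let asc_mseries : {measure set R -> \bar R} :=
  mseries (fun n => value_law (measurable_asc_event n)) 0.

HB.instance Definition _ := isMeasure.Build _ _ _ (desc_renewal X)
  (measure0 desc_mseries) (measure_ge0 desc_mseries)
  (@measure_semi_sigma_additive _ _ _ desc_mseries).

HB.instance Definition _ := isMeasure.Build _ _ _ (asc_renewal X)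
  (measure0 asc_mseries) (measure_ge0 asc_mseries)
  (@measure_semi_sigma_additive _ _ _ asc_mseries).

End renewal_is_measure.

(* Main.v *)
Require Import Defs.
From HB Require Import structures.
From mathcomp Require Import all_boot all_order all_algebra.
From mathcomp Require Import all_classical all_reals all_analysis.
From mathcomp Require Import measurable_realfun.
From mathcomp Require Import zify lra.
Import Order.TTheory GRing.Theory Num.Theory.
Import numFieldNormedType.Exports.

Set Implicit Arguments.
Unset Strict Implicit.
Unset Printing Implicit Defensive.

Local Open Scope classical_set_scope.
Local Open Scope ring_scope.
Local Open Scope ereal_scope.

(** Cut the path at the first time [m] at which it attains its minimum over
    [0, n]. The minimum is above [-x] iff [S_m] is, [m] is a strict descending
    record, and the remaining path of length [l = n - m] is independent of the
    past and stays nonnegative; this holds for both Green operators. Reversing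
    time turns the latter path into one with a weak ascending record at [l].
    Cutting once more, at the first time [k] at which the level [S_l] is
    reached, leaves a strict ascending record at [k] followed by a loop of
    length [l - k] that never exceeds its starting level. Hence the factorization
    holds with the constant [kappa], the sum over [n] of the probabilities of
    such loops of length [n].

    If [b] is the probability of returning to [0] with only negative values in
    between, counting the returns to [0] gives [kappa = 1 / (1 - b)]; and
    [b < 1] because an oscillating walk has upward steps. By cyclic shifts,
    [P(S_n = 0) / n] is the sum over [r >= 1] of [1 / r] times the probability
    of such a loop of length [n] with [r] returns; summing over [n] gives
    [c_eq = exp (sum_r b^r / r) = kappa]. *)

(** * Series with nonnegative extended-real terms *)

Section nneseries_complements.
Context {R : realType}.
Implicit Types (u v : nat -> \bar R).

(** The factor may be [+oo]: then either every term vanishes or one positive term makes both sides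
    [+oo]. This matters because the integrals and loop sums used as factors below are not known to
    be finite. *)
Lemma nneseriesZle (c : \bar R) u : 0 <= c -> (forall n, 0 <= u n) ->
  \sum_(0 <= n <oo) (c * u n) = c * \sum_(0 <= n <oo) u n.
Proof.
move=> c0 u0; case: c c0 => [r _|_|//]; first exact: nneseriesZl.
have [u_eq0|/existsNP[n /eqP un0]] := pselect (forall n, u n = 0).
  by rewrite !eseries0 ?mule0// => n _ _; rewrite u_eq0 ?mule0.
have un_gt0 : 0 < u n by rewrite lt_def un0 u0.
have cu0 k : 0 <= +oo * u k by exact: mule_ge0.
rewrite (@nneseries_pinfty _ (fun k => +oo * u k) _ n)//; last first.
  by rewrite gt0_mulye.
rewrite gt0_mulye//; rewrite (@nneseriesD1 _ u n xpredT)//.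
by rewrite (lt_le_trans un_gt0)// leeDl// nneseries_ge0.
Qed.

Lemma nneseries_shift (m : nat) u : (forall n, 0 <= u n) ->
  \sum_(0 <= n <oo) (if (m <= n)%N then u (n - m)%N else 0) =
  \sum_(0 <= n <oo) u n.
Proof.
move=> u0; have ifu0 n : 0 <= if (m <= n)%N then u (n - m)%N else 0.
  by case: ifP.
rewrite (@nneseries_split _ _ 0 m)// add0n big_nat big1 ?add0e; last first.
  by move=> i /andP[_ im]; rewrite leqNgt im.
rewrite -(@nneseries_addn _ _ m)//; apply: eq_eseriesr => n _.
by rewrite leq_addl addnK.
Qed.

(** Cutting a path of length [n] at time [m] produces convolutions; summing over all [n] frees the
    two lengths [m] and [l = n - m]. *)
Lemma nneseries_diagonal (a : nat -> nat -> \bar R) :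
  (forall m l, 0 <= a m l) ->
  \sum_(0 <= n <oo) \sum_(0 <= m <oo)
    (if (m <= n)%N then a m (n - m)%N else 0) =
  \sum_(0 <= m <oo) \sum_(0 <= l <oo) a m l.
Proof.
move=> a0; rewrite nneseries_interchange; last first.
  by move=> i j; case: ifP.
by apply: eq_eseriesr => m _; rewrite nneseries_shift.
Qed.

Lemma nneseries_delta (m : nat) u : (forall n, n <> m -> u n = 0) -> 0 <= u m ->
  \sum_(0 <= n <oo) u n = u m.
Proof.
move=> u0 um; rewrite (@nneseriesD1 _ u m xpredT)//; last first.
  by move=> k _; have [->//|/eqP/u0 ->] := eqVneq k m.
rewrite eseries0 ?adde0// => n _ /andP[_ /eqP]; exact: u0.
Qed.

End nneseries_complements.

(** * The product sigma-algebra on real sequences *)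

Section sequence_space.
Context {R : realType}.

(** Only finitely many coordinates are constrained, so that an i.i.d. law gives a box a finite
    product of one-step probabilities. *)
Definition boxes : set (set (nat -> R)) := [set B |
  exists n (A : nat -> set R), [/\ forall i, measurable (A i),
    forall i, (n <= i)%N -> A i = setT & B = [set s | forall i, A i (s i)]]].

Definition path_space := g_sigma_algebraType boxes.

Lemma boxesI : setI_closed boxes.
Proof.
move=> _ _ [n [A [mA An ->]]] [m [B [mB Bm ->]]].
exists (maxn n m), (fun i => A i `&` B i); split.
- by move=> i; exact: measurableI.
- by move=> i; rewrite geq_max => /andP[? ?]; rewrite An// Bm// setIT.
- by apply/seteqP; split=> s /= => [[As Bs] i|ABs]; split=> // i;
    have [] := ABs i.
Qed.

Lemma boxesT : boxes setT.
Proof.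
by exists 0%N, (fun=> setT); split=> //; apply/seteqP; split.
Qed.

Lemma measurable_coord (i : nat) :
  measurable_fun setT (fun s : path_space => s i).
Proof.
move=> _ A mA; rewrite setTI; apply: sub_sigma_algebra.
exists i.+1, (fun j => if j == i then A else setT); split.
- by move=> j; case: ifP.
- by move=> j ij; rewrite gtn_eqF.
- apply/seteqP; split=> s /= => [As j|/(_ i)]; last by rewrite eqxx.
  by case: eqP => // ->.
Qed.

Lemma measurable_fun_path d (T : measurableType d) (h : T -> path_space) :
  (forall i, measurable_fun setT (fun w => h w i)) -> measurable_fun setT h.
Proof.
move=> mh; have := @measurability _ _ T path_space setT h boxes erefl; apply.
move=> _ [_ [n [A [mA _ ->]]] <-].
rewrite setTI (_ : _ @^-1` _ =
  \bigcap_i ((fun w => h w i) @^-1` A i)); last first.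
  by apply/seteqP; split=> w /= => [hA i _|hA i]; exact: hA.
by apply: bigcapT_measurable => i; rewrite -[X in measurable X]setTI; exact: mh.
Qed.

(** The boxes form a generating pi-system that contains the whole space, so a finite measure is
    determined by its values on them. *)
Lemma eq_law_path (mu nu : probability path_space R) :
  (forall B, boxes B -> mu B = nu B) ->
  forall A, measurable A -> mu A = nu A.
Proof.
move=> mn; apply: (@measure_unique _ R path_space boxes (fun=> setT) erefl
  boxesI (fun=> boxesT) _ mu nu mn) => [|_].
- exact: bigcup_const.
- exact: le_lt_trans (@probability_le1 _ path_space _ mu setT measurableT)
    (ltry 1).
Qed.

End sequence_space.
Arguments path_space : clear implicits.
Arguments boxes : clear implicits.

(** * Reordering and concatenating paths *)

Section path_maps.
Context {R : realType}.

Definition reorder (sigma : nat -> nat) (s : path_space R) : path_space R :=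
  fun i => s (sigma i).

Definition splice (m : nat) (p : path_space R * path_space R) : path_space R :=
  fun i => if (i < m)%N then p.1 i else p.2 (i - m)%N.

Lemma measurable_reorder sigma : measurable_fun setT (reorder sigma).
Proof. by apply: measurable_fun_path => i; exact: measurable_coord. Qed.

Lemma measurable_splice m : measurable_fun setT (splice m).
Proof.
apply: measurable_fun_path => i; rewrite /splice.
by case: (i < m)%N; apply: (measurableT_comp (measurable_coord _)).
Qed.

HB.instance Definition _ sigma :=
  @isMeasurableFun.Build _ _ (path_space R) (path_space R)
    (reorder sigma) (measurable_reorder sigma).
HB.instance Definition _ m :=
  @isMeasurableFun.Build _ _ (path_space R * path_space R)%type (path_space R)
    (splice m) (measurable_splice m).

End path_maps.

(** * Exchangeability and the Markov property of an i.i.d. law *)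

Section iid_law.
Context {R : realType} (Pi : probability (path_space R) R).

(* [rho] is the law of one step; quantifying over the injective reorderings
   [sigma] of time builds exchangeability into the definition. *)
Definition iid_law := exists rho : set R -> \bar R,
  forall sigma tau, cancel sigma tau ->
  forall n (A : nat -> set R), (forall i, measurable (A i)) ->
    Pi [set s | forall i, (i < n)%N -> A i (s (sigma i))] =
    \prod_(i < n) rho (A i).

Hypothesis Pi_iid : iid_law.

Lemma measurable_cylinder n (A : nat -> set R) (sigma : nat -> nat) :
  (forall i, measurable (A i)) ->
  measurable
    ([set s | forall i, (i < n)%N -> A i (s (sigma i))] : set (path_space R)).
Proof.
move=> mA; rewrite (_ : [set s | _] = \bigcap_(i in [set i | (i < n)%N])
  ((fun s : path_space R => s (sigma i)) @^-1` A i))//.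
apply: bigcap_measurableType => i _; rewrite -[X in measurable X]setTI.
exact: measurable_coord.
Qed.

Lemma iid_law_reorder sigma tau : cancel sigma tau ->
  forall A, measurable A -> distribution Pi (reorder sigma) A = Pi A.
Proof.
move=> st; apply: eq_law_path => _ [n [A [mA An ->]]].
have [rho Pirho] := Pi_iid.
rewrite -[LHS]/(Pi (reorder sigma @^-1` [set s | forall i, A i (s i)])).
rewrite (_ : _ @^-1` _ =
    [set s | forall i, (i < n)%N -> A i (s (sigma i))]); last first.
  apply/seteqP; split=> s /= => [As i _|As i]; first exact: As.
  by have [ni|/As//] := leqP n i; rewrite An.
rewrite (_ : [set s | forall i, A i (s i)] =
    [set s | forall i, (i < n)%N -> A i (s i)]); last first.
  apply/seteqP; split=> s /= => [As i _|As i]; first exact: As.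
  by have [ni|/As//] := leqP n i; rewrite An.
by rewrite (Pirho _ _ st)// (Pirho id id).
Qed.

(** The Markov property at time [m]: following the past for [m] steps and then an independent copy
    of the path leaves the law unchanged. On boxes both sides are the same product. *)
Lemma iid_law_splice m :
  forall A, measurable A -> distribution (Pi \x Pi) (splice m) A = Pi A.
Proof.
apply: eq_law_path => _ [n [A [mA An ->]]].
have [rho Pirho] := Pi_iid.
have An' i : (n <= m + i)%N -> A (m + i)%N = setT by move=> /An.
rewrite -[LHS]/((Pi \x Pi) (splice m @^-1` [set s | forall i, A i (s i)])).
rewrite (_ : _ @^-1` _ =
    [set s | forall i, (i < m)%N -> A i (s i)] `*`
    [set s | forall i, (i < n)%N -> A (m + i)%N (s i)]); last first.
  apply/seteqP; split=> -[s t] /= => [As|[As At] i].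
    split=> i im; first by have := As i; rewrite /splice im.
    have := As (m + i)%N; rewrite /splice ltnNge leq_addr/=.
    by rewrite addnC addnK.
  rewrite /splice/=; case: ltnP => im; first exact: As.
  rewrite -[X in A X](subnKC im).
  have [nim|] := leqP n (i - m); last exact: At.
  by rewrite An'// (leq_trans nim)// leq_addl.
rewrite product_measure1E//=; last first.
- exact: (@measurable_cylinder n (fun i => A (m + i)%N) id).
- exact: (@measurable_cylinder m A id).
rewrite (Pirho id id)// (Pirho id id _ n (fun i => A (m + i)%N))//.
(* The coordinates beyond [n] being free, the box may be read on [m + n] coordinates, and the
   product splits at [m]. *)
rewrite (_ : [set s | forall i, A i (s i)] =
    [set s | forall i, (i < m + n)%N -> A i (s i)]); last first.
  apply/seteqP; split=> s /= => [As i _|As i]; first exact: As.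
  by have [ni|/As//] := leqP (m + n) i; rewrite An// (leq_trans _ ni)// leq_addl.
by rewrite (Pirho id id)// big_split_ord.
Qed.

Lemma ge0_integral_reorder sigma tau (E : set (path_space R))
    (Phi : path_space R -> \bar R) : cancel sigma tau -> measurable E ->
  measurable_fun setT Phi -> (forall s, 0 <= Phi s) ->
  \int[Pi]_(s in reorder sigma @^-1` E) Phi (reorder sigma s) =
  \int[Pi]_(s in E) Phi s.
Proof.
move=> st mE mPhi Phi0.
rewrite -(@ge0_integral_pushforward _ _ _ _ _ (reorder sigma) _ Pi E Phi)//.
  by apply: eq_measure_integral => A mA _; exact: (iid_law_reorder st).
exact: measurable_funTS.
Qed.

(** The form in which the Markov property is used: when an event separates at time [m] into a
    condition on the past and one on the future, Tonelli gives an iterated integral. *)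
Lemma ge0_integral_splice m (E E1 E2 : set (path_space R))
    (Phi : path_space R -> \bar R) :
  measurable E -> measurable E1 -> measurable E2 ->
  (forall s t, E (splice m (s, t)) <-> E1 s /\ E2 t) ->
  measurable_fun setT Phi -> (forall s, 0 <= Phi s) ->
  \int[Pi]_(s in E) Phi s =
  \int[Pi]_(s in E1) \int[Pi]_(t in E2) Phi (splice m (s, t)).
Proof.
move=> mE mE1 mE2 EE12 mPhi Phi0.
transitivity (\int[distribution (Pi \x Pi) (splice m)]_(s in E) Phi s).
  by apply: eq_measure_integral => A mA _; exact/esym/iid_law_splice.
rewrite ge0_integral_pushforward//; last exact: measurable_funTS.
rewrite (_ : splice m @^-1` E = E1 `*` E2); last first.
  by apply/seteqP; split=> -[s t] h; [apply: (EE12 s t).1|apply: (EE12 s t).2].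
rewrite integral_mkcond fubini_tonelli1//; last first.
- by move=> p; apply: erestrict_ge0 => q _; exact: Phi0.
- apply/(measurable_restrictT _ (measurableX mE1 mE2)).
  apply: measurable_funTS.
  by apply: measurableT_comp; [exact: mPhi|exact: measurable_splice].
rewrite [RHS]integral_mkcond; apply: eq_integral => s _.
rewrite /fubini_F [RHS]patchE; case: ifPn => [/set_mem E1s|/negP E1s].
  rewrite [RHS]integral_mkcond; apply: eq_integral => t _.
  by rewrite !patchE in_setX/= (mem_set E1s).
rewrite integral0_eq// => t _; rewrite patchE in_setX/=.
by case: ifP => // /andP[].
Qed.

Lemma iid_law_splice_prob m (E E1 E2 : set (path_space R)) :
  measurable E -> measurable E1 -> measurable E2 ->
  (forall s t, E (splice m (s, t)) <-> E1 s /\ E2 t) ->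
  Pi E = Pi E1 * Pi E2.
Proof.
move=> mE mE1 mE2 EE12.
have := @ge0_integral_splice m E E1 E2 (cst 1) mE mE1 mE2 EE12
  (measurable_cst _) (fun=> lee01).
rewrite integral_cst// mul1e => ->.
under eq_integral do rewrite integral_cst// mul1e.
by rewrite (integral_cst Pi mE1 (Pi E2)) muleC.
Qed.

End iid_law.

(** * Partial sums and their records *)

Section partial_sums.
Context {R : realType}.
Implicit Types (s t : path_space R).

Definition psum s (n : nat) : R := (\sum_(i < n) s i)%R.

Lemma psum0 s : psum s 0 = 0%R. Proof. exact: big_ord0. Qed.

Lemma psumS s n : psum s n.+1 = (psum s n + s n)%R.
Proof. exact: big_ord_recr. Qed.

Lemma psum_splice_head m s t j : (j <= m)%N ->
  psum (splice m (s, t)) j = psum s j.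
Proof.
move=> jm; apply: eq_bigr => i _.
by rewrite /splice (leq_trans (ltn_ord i) jm).
Qed.

Lemma psum_splice_tail m s t l :
  psum (splice m (s, t)) (m + l) = (psum s m + psum t l)%R.
Proof.
rewrite /psum big_split_ord/=; congr (_ + _)%R; apply: eq_bigr => i _.
  by rewrite /splice ltn_ord.
by rewrite /splice/= ltnNge leq_addr/= addnC addnK.
Qed.

Lemma measurable_psum n : measurable_fun setT (psum ^~ n).
Proof. by apply: measurable_sum => i; exact: measurable_coord. Qed.

Lemma measurable_psum_le i j : measurable [set s | (psum s i <= psum s j)%R].
Proof.
rewrite -[X in measurable X]setTI.
by apply: (measurable_fun_ler (measurable_psum i) (measurable_psum j)) => //;
  exact: (_ : measurable [set true]).
Qed.

Lemma measurable_psum_lt i j : measurable [set s | (psum s i < psum s j)%R].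
Proof.
rewrite -[X in measurable X]setTI.
by apply: (measurable_fun_ltr (measurable_psum i) (measurable_psum j)) => //;
  exact: (_ : measurable [set true]).
Qed.

Lemma measurable_psum_preimage n (A : set R) : measurable A ->
  measurable [set s | A (psum s n)].
Proof.
by move=> mA; rewrite -[X in measurable X]setTI; exact: (measurable_psum n).
Qed.

Lemma measurable_forall_nat (Q : nat -> bool) (E : nat -> set (path_space R)) :
  (forall j, measurable (E j)) -> measurable [set s | forall j, Q j -> E j s].
Proof.
move=> mE; rewrite (_ : [set s | _] = \bigcap_(j in [set j | Q j]) E j)//.
by apply: bigcap_measurableType => j _; exact: mE.
Qed.

Lemma measurable_guard (b : bool) (E : set (path_space R)) :
  measurable E -> measurable [set s | b /\ E s].
Proof.
move=> mE; case: b.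
  by rewrite (_ : [set s | _] = E)//; apply/seteqP; split=> s; [case|].
by rewrite (_ : [set s | _] = set0)//; apply/seteqP; split=> s // [].
Qed.

End partial_sums.

(** Strict inequality before [m] and weak inequality after it single out the first minimum, so the
    cutting time is unique. Applied to the opposite sequence this yields the first maximum. *)
Lemma first_argmin (R : realType) (u : nat -> R) (n : nat) : exists2 m,
  (m <= n)%N & (forall j, (j < m)%N -> (u m < u j)%R) /\
               (forall j, (m <= j <= n)%N -> (u m <= u j)%R).
Proof.
elim: n => [|n [m mn [um1 um2]]].
  exists 0%N => //; split=> // j; rewrite leqn0 => /eqP ->; exact: lexx.
have um j : (j <= n)%N -> (u m <= u j)%R.
  by move=> jn; have [/um1/ltW//|mj] := ltnP j m; rewrite um2// mj.
have [umn|umn] := leP (u m) (u n.+1).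
- exists m; first exact: leqW.
  split=> // j /andP[mj]; rewrite leq_eqVlt => /predU1P[->//|].
  by rewrite ltnS => /um.
- exists n.+1 => //; split=> j; first by rewrite ltnS => /um; exact: lt_le_trans.
  by rewrite -eqn_leq => /eqP <-.
Qed.

(** [F m] will be the event that the path is cut at time [m]; the last three hypotheses say that the
    cutting time exists on [E], only there, and is unique. *)
Lemma integral_partition d (T : measurableType d) (R : realType)
    (mu : {measure set T -> \bar R}) (E : set T) (F : nat -> set T)
    (Phi : T -> \bar R) :
  (forall m, measurable (F m)) -> measurable_fun setT Phi ->
  (forall s, 0 <= Phi s) ->
  (forall s, E s -> exists m, F m s) -> (forall m, F m `<=` E) ->
  (forall s m m', F m s -> F m' s -> m = m') ->
  \int[mu]_(s in E) Phi s = \sum_(0 <= m <oo) \int[mu]_(s in F m) Phi s.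
Proof.
move=> mF mPhi Phi0 EF FE Funiq.
rewrite (_ : E = \bigcup_m F m); last first.
  apply/seteqP; split=> s; first by move=> /EF[m Fms]; exists m.
  by move=> [m _] /FE.
rewrite ge0_integral_bigcup//; first exact: measurable_funTS.
by move=> m m' _ _ [s [Fs F's]]; exact: Funiq Fs F's.
Qed.

Lemma measure_partition d (T : measurableType d) (R : realType)
    (mu : {measure set T -> \bar R}) (E : set T) (F : nat -> set T) :
  (forall m, measurable (F m)) ->
  (forall s, E s -> exists m, F m s) -> (forall m, F m `<=` E) ->
  (forall s m m', F m s -> F m' s -> m = m') ->
  mu E = \sum_(0 <= m <oo) mu (F m).
Proof.
move=> mF EF FE Funiq.
have EE : E = \bigcup_m F m.
  apply/seteqP; split=> s; first by move=> /EF[m Fms]; exists m.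
  by move=> [m _] /FE.
rewrite EE; apply: esym; apply/cvg_lim => //; apply: measure_semi_sigma_additive => //.
  by move=> m m' _ _ [s [Fs F's]]; exact: Funiq Fs F's.
exact: bigcup_measurable.
Qed.

(** * Record events and time reversal *)

Section records.
Context {R : realType}.
Implicit Types (s t : path_space R).

Definition desc_record m : set (path_space R) :=
  [set s | forall j, (j < m)%N -> (psum s m < psum s j)%R].

Definition asc_record m : set (path_space R) :=
  [set s | forall j, (j < m)%N -> (psum s j < psum s m)%R].

Definition weak_asc_record m : set (path_space R) :=
  [set s | forall j, (j <= m)%N -> (psum s j <= psum s m)%R].

Definition stay_ge0 l : set (path_space R) :=
  [set s | forall j, (j <= l)%N -> (0 <= psum s j)%R].

Definition loop_le0 l : set (path_space R) :=
  [set s | psum s l = 0%R /\ forall j, (j <= l)%N -> (psum s j <= 0)%R].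

Lemma measurable_desc_record m : measurable (desc_record m).
Proof. by apply: measurable_forall_nat => j; exact: measurable_psum_lt. Qed.

Lemma measurable_asc_record m : measurable (asc_record m).
Proof. by apply: measurable_forall_nat => j; exact: measurable_psum_lt. Qed.

Lemma measurable_weak_asc_record m : measurable (weak_asc_record m).
Proof. by apply: measurable_forall_nat => j; exact: measurable_psum_le. Qed.

Lemma measurable_psum_ge0 j :
  measurable [set s : path_space R | (0 <= psum s j)%R].
Proof.
rewrite (_ : [set s | _] = [set s | (psum s 0 <= psum s j)%R]).
  exact: measurable_psum_le.
by apply/seteqP; split=> s /=; rewrite psum0.
Qed.

Lemma measurable_psum_le0 j :
  measurable [set s : path_space R | (psum s j <= 0)%R].
Proof.
rewrite (_ : [set s | _] = [set s | (psum s j <= psum s 0)%R]).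
  exact: measurable_psum_le.
by apply/seteqP; split=> s /=; rewrite psum0.
Qed.

Lemma measurable_psum_eq0 j : measurable [set s : path_space R | psum s j = 0%R].
Proof. exact: (@measurable_psum_preimage R j [set 0%R] (measurable_set1 _)). Qed.

Lemma measurable_stay_ge0 l : measurable (stay_ge0 l).
Proof. by apply: measurable_forall_nat => j; exact: measurable_psum_ge0. Qed.

Lemma measurable_loop_le0 l : measurable (loop_le0 l).
Proof.
rewrite (_ : loop_le0 l = [set s | psum s l = 0%R] `&`
  [set s | forall j, (j <= l)%N -> (psum s j <= 0)%R])//.
apply: measurableI; first exact: measurable_psum_eq0.
by apply: measurable_forall_nat => j; exact: measurable_psum_le0.
Qed.

(** Fixing the indices from [n] on makes this an involution of all of [nat], as needed for
    [iid_law]. *)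
Definition reversal (n i : nat) := if (i < n)%N then (n - i.+1)%N else i.

Lemma reversalK n : cancel (reversal n) (reversal n).
Proof. by move=> i; rewrite /reversal; case: ifP; case: ifP; lia. Qed.

Lemma psum_reversal n s j : (j <= n)%N ->
  psum (reorder (reversal n) s) j = (psum s n - psum s (n - j)%N)%R.
Proof.
elim: j => [|j IH] jn; first by rewrite psum0 subn0 subrr.
rewrite psumS IH ?(ltnW jn)// /reorder /reversal jn.
have -> : (n - j = (n - j.+1).+1)%N by lia.
by rewrite psumS; lra.
Qed.

(** The reversed walk is at [S_l - S_(l - j)] at time [j]; it lies below its final value [S_l]
    exactly when [S_(l - j)] is nonnegative. *)
Lemma reversal_weak_asc_record l :
  reorder (reversal l) @^-1` weak_asc_record l = stay_ge0 l.
Proof.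
apply/seteqP; split=> s /= h j jl.
  have := h (l - j)%N (leq_subr _ _).
  by rewrite !psum_reversal ?leq_subr// subKn// subnn psum0; lra.
rewrite !psum_reversal// subnn psum0.
by have := h (l - j)%N (leq_subr _ _); lra.
Qed.

End records.

(** * Cutting a path at its first minimum and at its first maximum *)

Section splitting.
Context {R : realType} (Pi : probability (path_space R) R).
Hypothesis Pi_iid : iid_law Pi.
Implicit Types (s t : path_space R) (F : R -> \bar R) (D : set R).

Lemma measurable_comp_psum F n :
  measurable_fun setT F -> measurable_fun setT (fun s => F (psum s n)).
Proof. by move=> mF; apply: measurableT_comp => //; exact: measurable_psum. Qed.

Lemma measurable_psum_opp D n : measurable D ->
  measurable [set s : path_space R | D (- psum s n)%R].
Proof.
move=> mD; apply: (@measurable_psum_preimage _ n [set u | D (- u)%R]).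
by rewrite -[X in measurable X]setTI; exact: (@oppr_measurable R setT).
Qed.

(** [D] stands for the depths [- S_k] that are allowed. As it is closed downwards, all depths are
    allowed once the largest one, reached at the first minimum [m], is. From [m] on the only
    constraint is to stay above [S_m], which concerns the future alone. *)
Lemma integral_split_argmin D F n :
  measurable D -> (forall u v, (u <= v)%R -> D v -> D u) ->
  measurable_fun setT F -> (forall u, 0 <= F u) ->
  \int[Pi]_(s in [set s | forall k, (k <= n)%N -> D (- psum s k)%R])
    F (psum s n) =
  \sum_(0 <= m <oo) if (m <= n)%N then
    \int[Pi]_(s in desc_record m `&` [set s | D (- psum s m)%R])
      \int[Pi]_(t in stay_ge0 (n - m)) F (psum s m + psum t (n - m)%N)%R
  else 0.
Proof.
move=> mD Ddown mF F0.
(* The guard [m <= n] empties [A m] for large [m], so that the series may run over all [m]. *)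
pose A m := [set s : path_space R | (m <= n)%N /\
  ((desc_record m `&` [set s | D (- psum s m)%R]) `&`
   [set s | forall j, (m <= j <= n)%N -> (psum s m <= psum s j)%R]) s].
have mE m :  measurable (desc_record m `&`
    [set s : path_space R | D (- psum s m)%R]).
  by apply: measurableI; [exact: measurable_desc_record|exact: measurable_psum_opp].
have mA' m : measurable ((desc_record m `&` [set s | D (- psum s m)%R]) `&`
   [set s | forall j, (m <= j <= n)%N -> (psum s m <= psum s j)%R]).
  apply: measurableI => //.
  apply: (@measurable_forall_nat _ (fun j => m <= j <= n)%N) => j.
  exact: measurable_psum_le.
rewrite (integral_partition Pi (F := A)).
- apply: eq_eseriesr => m _; case: ifPn => [mn|/negP mn]; last first.
    rewrite (_ : A m = set0) ?integral_set0//.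
    by apply/seteqP; split=> // s [].
  rewrite (_ : A m = (desc_record m `&` [set s | D (- psum s m)%R]) `&`
    [set s | forall j, (m <= j <= n)%N -> (psum s m <= psum s j)%R]); last first.
    by apply/seteqP; split=> s; [case|split].
  rewrite (ge0_integral_splice Pi_iid (m := m) (Phi := fun s => F (psum s n))
    (E1 := desc_record m `&` [set s | D (- psum s m)%R])
    (E2 := stay_ge0 (n - m)))//.
  + apply: eq_integral => s _; apply: eq_integral => t _.
    by rewrite -[in X in psum _ X](subnKC mn) psum_splice_tail.
  + exact: measurable_stay_ge0.
  + move=> s t; rewrite /desc_record /stay_ge0 /=.
    split=> [[[h1 h2] h3]|[[h1 h2] h3]].
      split; first split.
      * by move=> j jm; have := h1 _ jm; rewrite !psum_splice_head// ltnW.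
      * by move: h2; rewrite psum_splice_head.
      * move=> j jnm; have := h3 (m + j)%N.
        have mjn : (m <= m + j <= n)%N by lia.
        by rewrite psum_splice_tail psum_splice_head// => /(_ mjn); lra.
    split; first split.
    * by move=> j jm; rewrite !psum_splice_head ?(ltnW jm)//; exact: h1.
    * by rewrite psum_splice_head.
    * move=> j /andP[mj jn]; rewrite psum_splice_head// -(subnKC mj).
      rewrite psum_splice_tail; have := h3 (j - m)%N; rewrite leq_sub2r//.
      by move=> /(_ isT); lra.
  + exact: measurable_comp_psum.
- by move=> m; exact: measurable_guard.
- exact: measurable_comp_psum.
- by move=> s.
- move=> s Es; have [m mn [h1 h2]] := first_argmin (psum s) n.
  by exists m; split => //; split=> //; split => //; exact: Es.
- move=> m s [mn [[h1 h2] h3]] k kn; apply: Ddown h2; rewrite lerN2.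
  have [/h1/ltW//|mk] := ltnP k m; by rewrite h3// mk.
- move=> s m m' [mn [[h1 _] h2]] [m'n [[h1' _] h2']].
  have [mm'|mm'|//] := ltngtP m m'.
    by have := h1' _ mm'; rewrite ltNge h2// (ltnW mm').
  by have := h1 _ mm'; rewrite ltNge h2'// (ltnW mm').
Qed.

(** Reversing the first [l] steps preserves the law and the endpoint [S_l]. *)
Lemma integral_reversal F l : measurable_fun setT F -> (forall u, 0 <= F u) ->
  \int[Pi]_(t in stay_ge0 l) F (psum t l) =
  \int[Pi]_(t in weak_asc_record l) F (psum t l).
Proof.
move=> mF F0.
rewrite -(ge0_integral_reorder Pi_iid (@reversalK l)
  (E := weak_asc_record l) (Phi := fun t => F (psum t l)))//.
- rewrite reversal_weak_asc_record; apply: eq_integral => t _.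
  by rewrite psum_reversal// subnn psum0 subr0.
- exact: measurable_weak_asc_record.
- exact: measurable_comp_psum.
Qed.

(** The cut is at the first time [k] at which the maximum [S_l] is reached. As [S_k = S_l], the
    integrand depends on the past of [k] only, and the loop after [k] contributes just its
    probability. *)
Lemma integral_split_argmax F l : measurable_fun setT F -> (forall u, 0 <= F u) ->
  \int[Pi]_(t in weak_asc_record l) F (psum t l) =
  \sum_(0 <= k <oo) if (k <= l)%N then
    (\int[Pi]_(t in asc_record k) F (psum t k)) * Pi (loop_le0 (l - k)) else 0.
Proof.
move=> mF F0.
pose B k := asc_record k `&` [set s : path_space R | psum s k = psum s l /\
  forall j, (k <= j <= l)%N -> (psum s j <= psum s k)%R].
pose A k := [set s : path_space R | (k <= l)%N /\ B k s].
have mB k : measurable (B k).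
  apply: measurableI; first exact: measurable_asc_record.
  rewrite (_ : [set s | _] = [set s | psum s k = psum s l] `&`
    [set s | forall j, (k <= j <= l)%N -> (psum s j <= psum s k)%R])//.
  apply: measurableI.
    rewrite (_ : [set s | _] = [set s | (psum s k <= psum s l)%R] `&`
      [set s | (psum s l <= psum s k)%R]).
      by apply: measurableI; exact: measurable_psum_le.
    apply/seteqP; split=> s /=; first by move=> ->.
    by move=> [? ?]; apply/le_anti/andP.
  apply: (@measurable_forall_nat _ (fun j => k <= j <= l)%N) => j.
  exact: measurable_psum_le.
rewrite (integral_partition Pi (F := A)).
- apply: eq_eseriesr => k _; case: ifPn => [kl|/negP kl]; last first.
    rewrite (_ : A k = set0) ?integral_set0//.
    by apply/seteqP; split=> // s [].
  rewrite (_ : A k = B k); last first.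
    by apply/seteqP; split=> s; [case|split].
  rewrite (ge0_integral_splice Pi_iid (m := k) (Phi := fun s => F (psum s l))
    (E1 := asc_record k) (E2 := loop_le0 (l - k)))//.
  + rewrite -ge0_integralZr//; last first.
    * by apply: measurable_funTS; exact: measurable_comp_psum.
    * exact: measurable_asc_record.
    apply: eq_integral => s _.
    rewrite -[RHS](@integral_cst _ _ _ Pi)//; last exact: measurable_loop_le0.
    apply: eq_integral => t /set_mem[t0 _].
    by rewrite -[in X in psum _ X](subnKC kl) psum_splice_tail t0 addr0.
  + exact: measurable_asc_record.
  + exact: measurable_loop_le0.
  + move=> s t; rewrite /B /asc_record /loop_le0 /=.
    have El : psum (splice k (s, t)) l = (psum s k + psum t (l - k)%N)%R.
      by rewrite -{1}(subnKC kl) psum_splice_tail.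
    rewrite El psum_splice_head//.
    split=> [[h1 [h2 h3]]|[h1 [h2 h3]]].
      split; first by move=> j jk; have := h1 _ jk; rewrite psum_splice_head// ltnW.
      split; first by move: h2; lra.
      move=> j jlk; have := h3 (k + j)%N.
      have kjl : (k <= k + j <= l)%N by lia.
      by rewrite psum_splice_tail => /(_ kjl); lra.
    split; first by move=> j jk; rewrite psum_splice_head ?(ltnW jk)//; exact: h1.
    split; first by rewrite h2 addr0.
    move=> j /andP[kj jl]; rewrite -(subnKC kj) psum_splice_tail.
    by have := h3 (j - k)%N; rewrite leq_sub2r// => /(_ isT); lra.
  + exact: measurable_comp_psum.
- by move=> m; exact: measurable_guard.
- exact: measurable_comp_psum.
- by move=> s.
- move=> s Es; have [k kl [h1 h2]] := first_argmin (fun i => - psum s i)%R l.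
  exists k; split => //; split; first by move=> j /h1; rewrite ltrN2.
  split; last by move=> j /h2; rewrite lerN2.
  by apply/le_anti; rewrite Es// -lerN2 h2// kl leqnn.
- move=> k s [kl [h1 [h2 h3]]] j jl; rewrite -h2.
  by have [/h1/ltW//|kj] := ltnP j k; rewrite h3// kj.
- move=> s m m' [mn [h1 [_ h2]]] [m'n [h1' [_ h2']]].
  have [mm'|mm'|//] := ltngtP m m'.
    by have := h1' _ mm'; rewrite ltNge h2// (ltnW mm').
  by have := h1 _ mm'; rewrite ltNge h2'// (ltnW mm').
Qed.

End splitting.

(** * Loops that never exceed their starting level *)

Section loops.
Context {R : realType} (Pi : probability (path_space R) R).
Hypothesis Pi_iid : iid_law Pi.
Implicit Types (s t : path_space R).

Lemma measurable_count (b : nat -> path_space R -> bool) l r :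
  (forall i, measurable [set s | b i s]) ->
  measurable [set s | (\sum_(i < l) b i s = r)%N].
Proof.
move=> mb; elim: l r => [|l IH] r.
  have [->|r0] := eqVneq r 0%N.
    rewrite (_ : [set s | _] = setT)//.
    by apply/seteqP; split=> s // _ /=; rewrite big_ord0.
  rewrite (_ : [set s | _] = set0)//; apply/seteqP; split=> s //=.
  by rewrite big_ord0 => r0'; rewrite -r0' eqxx in r0.
(* The last indicator either counts or does not. In the first case [0 < r] must be required, because
   [r.-1] is [0] when [r = 0]. *)
rewrite (_ : [set s | _] =
  ([set s | (0 < r)%N /\ [set s | (\sum_(i < l) b i s = r.-1)%N] s] `&`
    [set s | b l s]) `|`
  ([set s | (\sum_(i < l) b i s = r)%N] `\` [set s | b l s])).
  apply: measurableU; last exact: measurableD.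
  by apply: measurableI => //; exact: measurable_guard.
apply/seteqP; split=> s /=; rewrite big_ord_recr/=.
  by case: (b l s) => /=; [left|right]; split => //; lia.
by move=> [[[]]|[]]; case: (b l s) => //=; lia.
Qed.

(** Time [0] is counted and time [n] is not; for a loop of length [n] this is the number of returns
    to [0] up to and including time [n]. *)
Definition zeros s n := (\sum_(i < n) (psum s i == 0%R))%N.

Definition loop_zeros r n : set (path_space R) :=
  loop_le0 n `&` [set s | zeros s n = r].

Definition first_return n : set (path_space R) :=
  [set s | (0 < n)%N /\
    [set s | psum s n = 0%R /\
      forall j, (0 < j < n)%N -> (psum s j < 0)%R] s].

Lemma measurable_psum_lt0 j : measurable [set s : path_space R | (psum s j < 0)%R].
Proof.
rewrite (_ : [set s | _] = [set s | (psum s j < psum s 0)%R]).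
  exact: measurable_psum_lt.
by apply/seteqP; split=> s /=; rewrite psum0.
Qed.

Lemma measurable_loop_zeros r n : measurable (loop_zeros r n).
Proof.
apply: measurableI; first exact: measurable_loop_le0.
apply: (@measurable_count (fun i s => psum s i == 0%R)) => i.
rewrite (_ : [set s | _] = [set s | psum s i = 0%R]).
  exact: measurable_psum_eq0.
by apply/seteqP; split=> s /= /eqP.
Qed.

Lemma measurable_first_return n : measurable (first_return n).
Proof.
apply: measurable_guard.
rewrite (_ : [set s | _] = [set s | psum s n = 0%R] `&`
  [set s | forall j, (0 < j < n)%N -> (psum s j < 0)%R])//.
apply: measurableI; first exact: measurable_psum_eq0.
apply: (@measurable_forall_nat _ (fun j => 0 < j < n)%N) => j.
exact: measurable_psum_lt0.
Qed.

Lemma loop_zeros00 : loop_zeros 0 0 = setT.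
Proof.
apply/seteqP; split=> s // _; split; last by rewrite /zeros/= big_ord0.
by split; rewrite ?psum0// => j; rewrite leqn0 => /eqP ->; rewrite psum0.
Qed.

Lemma loop_zerosS0 r : loop_zeros r.+1 0 = set0.
Proof. by apply/seteqP; split=> s // [_]; rewrite /zeros/= big_ord0. Qed.

Lemma loop_zeros0S n : loop_zeros 0 n.+1 = set0.
Proof.
by apply/seteqP; split=> s // [_]; rewrite /zeros/= big_ord_recl psum0 eqxx.
Qed.

(** A loop with [r.+1] returns is cut at its first return [k]; what follows is an independent loop
    with [r] returns. *)
Lemma prob_loop_zerosS r n : Pi (loop_zeros r.+1 n) =
  \sum_(0 <= k <oo) if (k <= n)%N then
    Pi (first_return k) * Pi (loop_zeros r (n - k)) else 0.
Proof.
pose A k := [set s | (k <= n)%N /\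
  (loop_zeros r.+1 n `&` first_return k) s].
rewrite (measure_partition Pi (F := A)).
- apply: eq_eseriesr => k _; case: ifPn => [kn|/negP kn]; last first.
    rewrite (_ : A k = set0) ?measure0//.
    by apply/seteqP; split=> // s [].
  rewrite (_ : A k = loop_zeros r.+1 n `&` first_return k); last first.
    by apply/seteqP; split=> s; [case|split].
  apply: (iid_law_splice_prob Pi_iid (m := k)).
  + by apply: measurableI;
      [exact: measurable_loop_zeros|exact: measurable_first_return].
  + exact: measurable_first_return.
  + exact: measurable_loop_zeros.
  + move=> s t; rewrite /loop_zeros /loop_le0 /first_return /=.
    have Etl j : psum (splice k (s, t)) (k + j) = (psum s k + psum t j)%R.
      exact: psum_splice_tail.
    have En : psum (splice k (s, t)) n = (psum s k + psum t (n - k)%N)%R.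
      by rewrite -{1}(subnKC kn) Etl.
    rewrite En psum_splice_head//.
    (* Before time [k] the only zero is the one at time [0], so the first excursion adds exactly
       one. *)
    have zE : (0 < k)%N -> psum s k = 0%R ->
        (forall j, (0 < j < k)%N -> (psum s j < 0)%R) ->
        zeros (splice k (s, t)) n = (zeros t (n - k)).+1.
      move=> k0 sk0 sneg; rewrite -{1}(subnKC kn) /zeros big_split_ord/=.
      rewrite -add1n; congr addn; last first.
        by apply: eq_bigr => i _; rewrite Etl sk0 add0r.
      case: k k0 sneg {kn Etl En sk0} => // k _ sneg.
      rewrite big_ord_recl psum0 eqxx big1 ?addn0// => i _ /=.
      rewrite psum_splice_head//; last by rewrite /bump; case: i => /=; lia.
      by rewrite lt_eqF// sneg// /bump/=; case: i => /= i; lia.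
    split=> [[[[h1 h2] hz] [k0 [sk0 sneg]]]|[[k0 [sk0 sneg]] [[h1 h2] hz]]].
      have sneg' j : (0 < j < k)%N -> (psum s j < 0)%R.
        by move=> jk; have := sneg _ jk; rewrite psum_splice_head//; lia.
      split=> //; split.
        split; first by rewrite -h1 sk0 add0r.
        move=> j jnk; have := h2 (k + j)%N; rewrite Etl sk0 add0r; apply; lia.
      by move: hz; rewrite zE// => -[].
    split; last first.
      split=> //; split=> // j jk; rewrite psum_splice_head; first exact: sneg.
      by lia.
    split; last by rewrite zE// hz.
    split; first by rewrite sk0 h1 addr0.
    move=> j jn; have [jk|kj] := ltnP j k.
      rewrite psum_splice_head ?(ltnW jk)//.
      have [->|j0] := posnP j; first by rewrite psum0.
      by rewrite ltW// sneg// j0.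
    by rewrite -(subnKC kj) Etl sk0 add0r h2// leq_sub2r.
- move=> k; apply: measurable_guard; apply: measurableI.
    exact: measurable_loop_zeros.
  exact: measurable_first_return.
- move=> s [[h1 h2] hz].
  (* A positive number of zeros excludes [n = 0]; then [n] itself is a return time and a first one
     exists. *)
  have n0 : (0 < n)%N.
    by case: n hz {A h1 h2} => //; rewrite /= /zeros big_ord0.
  have ex : exists k, (0 < k)%N && (psum s k == 0%R).
    by exists n; rewrite n0 h1 eqxx.
  case: (ex_minnP ex) => k /andP[k0 /eqP sk0] kmin.
  have kn : (k <= n)%N by apply: kmin; rewrite n0 h1 eqxx.
  exists k; split => //; split=> //; split => //; split => // j /andP[j0 jk].
  rewrite lt_neqAle h2 ?andbT; last by rewrite ltnW// (leq_trans jk).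
  apply/negP => sj0; have := kmin j; rewrite j0 sj0 => /(_ isT).
  by rewrite leqNgt jk.
- by move=> k s [_ []].
- move=> s k k' [_ [_ [k0 [sk0 sneg]]]] [_ [_ [k0' [sk0' sneg']]]].
  have [kk'|kk'|//] := ltngtP k k'.
    by have := sneg' k; rewrite k0 kk' sk0 ltxx => /(_ isT).
  by have := sneg k'; rewrite k0' kk' sk0' ltxx => /(_ isT).
Qed.

Definition return_prob : \bar R := \sum_(0 <= k <oo) Pi (first_return k).

Fixpoint return_pow r : \bar R :=
  if r is r'.+1 then return_prob * return_pow r' else 1.

(** The total mass of a convolution is the product of the masses, and each return contributes one
    factor [return_prob]. *)
Lemma sum_prob_loop_zeros r :
  \sum_(0 <= n <oo) Pi (loop_zeros r n) = return_pow r.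
Proof.
elim: r => [|r IH] /=.
  rewrite (@nneseries_delta _ 0%N)//; first by rewrite loop_zeros00 probability_setT.
  by case=> // n _; rewrite loop_zeros0S measure0.
under eq_eseriesr do rewrite prob_loop_zerosS.
rewrite (nneseries_diagonal
  (a := fun k l => Pi (first_return k) * Pi (loop_zeros r l))); last first.
  by move=> k l; exact: mule_ge0.
under eq_eseriesr do rewrite nneseriesZle// IH muleC.
rewrite [RHS]muleC /return_prob -nneseriesZle//.
by rewrite -IH; exact: nneseries_ge0.
Qed.

(** Loops are sorted by their number of returns, which turns their total mass into a geometric
    series. *)
Lemma sum_prob_loop_le0 :
  \sum_(0 <= n <oo) Pi (loop_le0 n) = \sum_(0 <= r <oo) return_pow r.
Proof.
under [RHS]eq_eseriesr do rewrite -sum_prob_loop_zeros.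
rewrite nneseries_interchange//; apply: eq_eseriesr => n _.
apply: measure_partition => [r|s|r s|s r r'].
- exact: measurable_loop_zeros.
- by move=> sn; exists (zeros s n).
- by case.
- by move=> [_ <-] [_ <-].
Qed.

End loops.

(** * Cyclic shifts of closed paths *)

Section cyclic_shift.
Context {R : realType} (Pi : probability (path_space R) R).
Hypothesis Pi_iid : iid_law Pi.
Implicit Types (s t : path_space R).

Definition rotation n i :=
  if (i.+1 < n)%N then i.+1 else if i.+1 == n then 0%N else i.

Definition rotation_inv n i :=
  if (i < n)%N then (if i == 0%N then n.-1 else i.-1) else i.

Lemma rotationK n : cancel (rotation n) (rotation_inv n).
Proof.
move=> i; rewrite /rotation /rotation_inv; have [|ni|<-] := ltngtP i.+1 n.
- by move=> ->.
- by case: ifP => //; lia.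
- by rewrite ltnS leq0n eqxx.
Qed.

Lemma psum_rotation n s j : (j < n)%N ->
  psum (reorder (rotation n) s) j = (psum s j.+1 - s 0%N)%R.
Proof.
elim: j => [|j IH] jn; first by rewrite psum0 psumS psum0 add0r subrr.
rewrite psumS IH ?(ltnW jn)// [in RHS]psumS /reorder /rotation jn.
by rewrite addrAC.
Qed.

Lemma psum_rotation_full n s : psum (reorder (rotation n) s) n = psum s n.
Proof.
case: n => [|n]; first by rewrite !psum0.
rewrite psumS psum_rotation// /reorder /rotation ltnn eqxx.
by rewrite subrK.
Qed.

Definition is_argmax n s i := [forall j : 'I_n, (psum s j <= psum s i)%R].

Definition nb_argmax n s := (\sum_(i < n) is_argmax n s i)%N.

Lemma is_argmaxP n s i :
  reflect (forall j, (j < n)%N -> (psum s j <= psum s i)%R) (is_argmax n s i).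
Proof.
apply: (iffP forallP) => [h j jn|h j]; first exact: (h (Ordinal jn)).
exact: h.
Qed.

(** The shift lowers every value by the first step and moves each vertex back by one place.
    Closedness identifies vertex [n] with vertex [0], so no value is gained or lost. *)
Lemma is_argmax_rotation n s i : psum s n = 0%R -> (i < n)%N ->
  is_argmax n (reorder (rotation n) s) i = is_argmax n s i.+1.
Proof.
move=> sn0 ilt; apply/is_argmaxP/is_argmaxP => h j jn.
- have n0 : (0 < n)%N := leq_ltn_trans (leq0n _) ilt.
  have [->|j0] := posnP j.
    rewrite psum0 -sn0; have := h n.-1; rewrite prednK// leqnn => /(_ isT).
    by rewrite !psum_rotation ?prednK// lerD2r.
  have jlt : (j.-1 < n)%N by rewrite prednK// ltnW.
  by have := h _ jlt; rewrite !psum_rotation// lerD2r prednK.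
- rewrite !psum_rotation// lerD2r.
  have [/h//|] := ltnP j.+1 n; rewrite leq_eqVlt => /predU1P[<-|].
    by rewrite sn0 -(psum0 s) h// (leq_ltn_trans _ ilt).
  by rewrite ltnNge jn.
Qed.

Lemma nb_argmax_rotation n s : psum s n = 0%R ->
  nb_argmax n (reorder (rotation n) s) = nb_argmax n s.
Proof.
move=> sn0; rewrite /nb_argmax.
transitivity (\sum_(i < n) is_argmax n s i.+1)%N.
  by apply: eq_bigr => i _; rewrite is_argmax_rotation.
(* The sum over [n.+1] vertices is peeled at either end; the end terms agree because [S_n = S_0]. *)
have : (\sum_(i < n.+1) is_argmax n s i =
        is_argmax n s 0 + \sum_(i < n) is_argmax n s i.+1)%N.
  by rewrite big_ord_recl.
rewrite big_ord_recr/= (_ : is_argmax n s n = is_argmax n s 0); last first.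
  by rewrite /is_argmax sn0 psum0.
by rewrite addnC => /addnI ->.
Qed.

Definition bridge r n : set (path_space R) :=
  [set s | psum s n = 0%R] `&` [set s | nb_argmax n s = r].

Lemma measurable_is_argmax n i : measurable [set s | is_argmax n s i].
Proof.
rewrite (_ : [set s | _] =
    [set s | forall j, (j < n)%N -> (psum s j <= psum s i)%R]).
  by apply: measurable_forall_nat => j; exact: measurable_psum_le.
by apply/seteqP; split=> s /is_argmaxP.
Qed.

Lemma measurable_bridge r n : measurable (bridge r n).
Proof.
apply: measurableI; first exact: measurable_psum_eq0.
by apply: (@measurable_count _ (fun i s => is_argmax n s i)) => i;
  exact: measurable_is_argmax.
Qed.

(** The rotation preserves the law and the event [bridge r n], and carries a maximum at [i.+1] to
    one at [i]. *)
Lemma prob_bridge_argmax r n i : (i < n)%N ->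
  Pi (bridge r n `&` [set s | is_argmax n s i]) =
  Pi (bridge r n `&` [set s | is_argmax n s 0]).
Proof.
elim: i => [//|i IH] ilt; rewrite -IH ?(ltnW ilt)//.
rewrite -(iid_law_reorder Pi_iid (@rotationK n)
  (A := bridge r n `&` [set s | is_argmax n s i])); last first.
  by apply: measurableI; [exact: measurable_bridge|exact: measurable_is_argmax].
rewrite /distribution /pushforward; congr (Pi _); apply/seteqP; split=> s /=.
  move=> [[/= sn0 sr] si]; split; last by rewrite /= is_argmax_rotation// ltnW.
  by split; rewrite /= ?psum_rotation_full ?nb_argmax_rotation.
rewrite /bridge /= psum_rotation_full => -[[sn0 sr] si].
rewrite -(is_argmax_rotation sn0 (ltnW ilt)); split=> //.
by split=> //; rewrite -(nb_argmax_rotation sn0).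
Qed.

(** If a closed path has a maximum at time [0], its maximal value is [0]: it is a loop that never
    exceeds [0], and its maxima are its zeros. *)
Lemma bridge_argmax0 r n : (0 < n)%N ->
  bridge r n `&` [set s | is_argmax n s 0] = loop_zeros r n.
Proof.
move=> n0.
have E s : loop_le0 n s -> nb_argmax n s = zeros s n.
  move=> [sn0 s_le0]; apply: eq_bigr => i _; congr nat_of_bool.
  apply/is_argmaxP/eqP => [h|-> j jn]; last exact/s_le0/ltnW.
  apply/le_anti; rewrite s_le0 ?(ltnW (ltn_ord i))//=.
  by rewrite -[leLHS](psum0 s) h.
have L s : loop_le0 n s <-> psum s n = 0%R /\ is_argmax n s 0.
  split=> [[sn0 s_le0]|[sn0 /is_argmaxP h]].
    by split=> //; apply/is_argmaxP => j jn; rewrite psum0 s_le0// ltnW.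
  split=> // j; rewrite leq_eqVlt => /predU1P[->|/h]; first by rewrite sn0.
  by rewrite psum0.
apply/seteqP; split=> s.
  move=> [[/= sn0 sr] s0]; have Ls : loop_le0 n s by apply/L.
  by split=> //=; rewrite -E.
move=> [Ls /= zr]; have [sn0 s0] := (L s).1 Ls.
by split=> //; split=> //=; rewrite E.
Qed.

(* A closed path with [r] maxima among its [n] vertices has exactly [r] cyclic
   shifts, out of [n], that start at a maximum. *)
Lemma prob_loop_bridge r n : (0 < n)%N ->
  n%:R%:E * Pi (loop_zeros r n) = r%:R%:E * Pi (bridge r n).
Proof.
move=> n0; rewrite -bridge_argmax0//.
transitivity (\sum_(i < n) Pi (bridge r n `&` [set s | is_argmax n s i])).
  rewrite (eq_bigr (fun=> Pi (bridge r n `&` [set s | is_argmax n s 0]))).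
    by rewrite sumr_const card_ord mule_natl.
  by move=> i _; rewrite prob_bridge_argmax.
transitivity (\int[Pi]_(s in bridge r n)
    \sum_(i < n) (\1_[set s | is_argmax n s i] s)%:E).
  rewrite ge0_integral_sum//; last first.
  - move=> i; apply: measurable_funTS; apply/measurable_EFinP.
    by apply: measurable_indic; exact: measurable_is_argmax.
  - exact: measurable_bridge.
  apply: eq_bigr => i _; rewrite integral_indic; first by rewrite setIC.
    exact: measurable_bridge.
  exact: measurable_is_argmax.
rewrite -[RHS](@integral_cst _ _ _ Pi)//; last exact: measurable_bridge.
apply: eq_integral => s /set_mem[_ /= <-].
rewrite sumEFin /nb_argmax natr_sum; congr EFin; apply: eq_bigr => i _.
by rewrite indicE; case: (boolP (is_argmax n s i)) => h;
  [rewrite mem_set|rewrite memNset//; exact/negP].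
Qed.

(** [prob_loop_bridge] trades the weight [1 / r] on loops for the weight [1 / n] on closed paths
    with [r] maxima. Every closed path of positive length has a maximum, so the values [r >= 1]
    exhaust the event [S_n = 0]. *)
Lemma prob_return_zeros n : (n.+1%:R^-1)%:E * Pi [set s | psum s n.+1 = 0%R] =
  \sum_(0 <= r <oo) (r.+1%:R^-1)%:E * Pi (loop_zeros r.+1 n.+1).
Proof.
have bE r : (r.+1%:R^-1)%:E * Pi (loop_zeros r.+1 n.+1) =
    (n.+1%:R^-1)%:E * Pi (bridge r.+1 n.+1).
  transitivity ((r.+1%:R^-1 * n.+1%:R^-1)%:E *
      (n.+1%:R%:E * Pi (loop_zeros r.+1 n.+1))).
    by rewrite muleA -EFinM mulfVK// pnatr_eq0.
  rewrite prob_loop_bridge// muleA -EFinM.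
  by rewrite mulrAC mulVf ?mul1r// pnatr_eq0.
under eq_eseriesr do rewrite bE.
rewrite nneseriesZl//; congr (_ * _).
apply: measure_partition => [r|s sn0|r s []//|s r r' [_ /= E] [_ /= E']].
- exact: measurable_bridge.
- suff : (0 < nb_argmax n.+1 s)%N.
    by move=> h; exists (nb_argmax n.+1 s).-1; split=> //=; rewrite prednK.
  have [m mn [h1 h2]] := first_argmin (fun i => - psum s i)%R n.
  rewrite /nb_argmax (bigD1 (Ordinal (mn : (m < n.+1)%N)))//=.
  rewrite (_ : is_argmax _ _ _)//; apply/is_argmaxP => j.
  rewrite ltnS => jn; rewrite -lerN2.
  by have [/h1/ltW//|mj] := ltnP j m; rewrite h2// mj.
- by move: E'; rewrite E => -[].
Qed.

End cyclic_shift.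

(** * The constant c_eq *)

Section log_series.
Context {R : realType}.
Implicit Types (x y : R).

(** The Taylor polynomial of [- ln (1 - x)]. *)
Let log_partial (n : nat) x : R := (\sum_(i < n) i.+1%:R^-1 * x ^+ i.+1)%R.

Let is_derive_log_partial n x :
  is_derive x 1%R (log_partial n) (\sum_(i < n) x ^+ i)%R.
Proof.
elim: n => [|n IH].
  rewrite /log_partial big_ord0.
  rewrite (_ : (fun _ => _) = cst 0%R); first exact: is_derive_cst.
  by apply/funext => y; rewrite big_ord0.
rewrite big_ord_recr/=.
rewrite (_ : log_partial n.+1 =
  (log_partial n \+ (fun y => n.+1%:R^-1 * y ^+ n.+1))%R); last first.
  by apply/funext => y; rewrite /log_partial big_ord_recr.
apply: is_deriveD.
have H : is_derive x 1%R (fun y : R => y ^+ n.+1)%R (n.+1%:R * x ^+ n)%R.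
  have := @is_deriveX R R id n.+1 x 1%R 1%R (is_derive_id _ _).
  rewrite /GRing.scale/= mulr1; congr (is_derive _ _ _ _).
  by rewrite exprfctE.
have := @is_deriveZ R R R _ (n.+1%:R^-1)%R x 1%R _ H.
by rewrite /GRing.scale/= mulrA mulVf ?mul1r// pnatr_eq0.
Qed.

(** The derivative of the left-hand expression is a finite geometric sum minus the full one, that is
    [- c ^+ n / (1 - c)]. The mean value theorem on [[0, y]] applies, the expression being [0] at
    [0], and [c <= y < 1] gives the bound. *)
Lemma log_series_bound n y : (0 <= y < 1)%R ->
  (`|log_partial n y + ln (1 - y)| <= (1 - y)^-1 * y ^+ n)%R.
Proof.
move=> /andP[y0 y1].
pose g x : R := (log_partial n x + ln (1 - x))%R.
have dg x : (x < 1)%R ->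
    is_derive x 1%R g (\sum_(i < n) x ^+ i - (1 - x)^-1)%R.
  move=> x1; apply: is_deriveD; first exact: is_derive_log_partial.
  have x1' : (0 < 1 - x)%R by rewrite subr_gt0.
  have d1 : is_derive x 1%R (fun z : R => 1 - z)%R (- 1)%R.
    have := @is_deriveB R R R (cst 1%R) id x 1%R 0%R 1%R.
    by rewrite sub0r; exact.
  have := @is_derive1_comp _ (@ln R) (fun z => 1 - z)%R _ _ _ (is_derive1_ln x1') d1.
  by rewrite mulrN1.
have [c cy] : exists2 c, c \in `[0%R, y] &
    (g y - g 0 = (\sum_(i < n) c ^+ i - (1 - c)^-1) * (y - 0))%R.
  apply: MVT_segment => //.
    by move=> x; rewrite in_itv/= => /andP[_ xy]; apply: dg; exact: lt_trans y1.
  apply: derivable_within_continuous => x; rewrite in_itv/= => /andP[_ xy].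
  by have /@ex_derive := dg x (le_lt_trans xy y1).
have c1 : (c < 1)%R by move: cy; rewrite in_itv/= => /andP[_ /le_lt_trans]; exact.
have c0 : (0 <= c)%R by move: cy; rewrite in_itv/= => /andP[].
have c1' : (0 < 1 - c)%R by rewrite subr_gt0.
have -> : (\sum_(i < n) c ^+ i - (1 - c)^-1)%R = (- (c ^+ n / (1 - c)))%R.
  apply: (mulfI (lt0r_neq0 c1')).
  rewrite mulrBr mulfV ?lt0r_neq0// mulrN mulrCA mulfV ?lt0r_neq0// mulr1.
  have := subrX1 c n; lra.
rewrite subr0 {2}/g subr0 ln1 addr0.
rewrite (_ : log_partial n 0 = 0%R) ?subr0; last first.
  by apply: big1 => i _; rewrite expr0n mulr0.
rewrite /g => ->; rewrite mulNr normrN ger0_norm; last first.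
  by rewrite mulr_ge0// divr_ge0 ?exprn_ge0// ltW.
rewrite -[leRHS]mulr1 ler_pM//; last exact: ltW.
  by rewrite divr_ge0 ?exprn_ge0// ltW.
rewrite mulrC ler_pM ?invr_ge0 ?exprn_ge0 ?(ltW c1')//.
  rewrite lef_pV2 ?posrE ?subr_gt0// lerB//.
  by move: cy; rewrite in_itv/= => /andP[].
by apply: lerXn2r; rewrite ?nnegrE//; move: cy; rewrite in_itv/= => /andP[].
Qed.

Lemma nneseries_EFin_cvg (u : nat -> R) (l : R) :
  (\sum_(i < n) u i)%R @[n --> \oo] --> l ->
  \sum_(0 <= n <oo) (u n)%:E = l%:E.
Proof.
move=> ul; apply/cvg_lim => //.
rewrite (_ : (fun _ => _) = EFin \o (fun n => \sum_(i < n) u i)%R).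
  by apply: cvg_EFin; [exact: nearW|exact: ul].
by apply/funext => n; rewrite big_mkord sumEFin.
Qed.

Lemma log_series y : (0 <= y < 1)%R ->
  \sum_(0 <= n <oo) (n.+1%:R^-1 * y ^+ n.+1)%:E = (- ln (1 - y))%:E.
Proof.
move=> y01; apply: nneseries_EFin_cvg.
have y1 : (`|y| < 1)%R by case/andP: y01 => y0 ?; rewrite ger0_norm.
have h : (geometric ((1 - y)^-1) y n @[n --> \oo] --> (0 : R))%R.
  exact: cvg_geometric.
apply/cvgrPdist_le => e e0.
move/cvgrPdist_le : h => /(_ e e0); apply: filterS => n /=.
rewrite sub0r normrN => he; rewrite -opprD normrN addrC.
apply: le_trans (log_series_bound n y01) _.
exact: le_trans (ler_norm _) he.
Qed.

Lemma geometric_nneseries y : (0 <= y < 1)%R ->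
  \sum_(0 <= n <oo) (y ^+ n)%:E = ((1 - y)^-1)%:E.
Proof.
move=> /andP[y0 y1]; apply: nneseries_EFin_cvg.
have := @cvg_geometric_series R 1%R y; rewrite ger0_norm// => /(_ y1).
rewrite mul1r (_ : series _ = (fun n => \sum_(i < n) y ^+ i)%R)//.
apply/funext => n; rewrite /series/= big_mkord; apply: eq_bigr => i _.
by rewrite /geometric/= mul1r.
Qed.

End log_series.

Section loop_mass.
Context {R : realType} (Pi : probability (path_space R) R).
Hypothesis Pi_iid : iid_law Pi.
Hypothesis up_step : 0 < Pi [set s : path_space R | (0 < psum s 1)%R].

(** First returns at different times are disjoint events, and none of them is possible after a first
    step upwards. So the total is at most one minus the probability of such a step. *)
Lemma return_prob_lt1 : return_prob Pi < 1.
Proof.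
pose U := [set s : path_space R | (0 < psum s 1)%R].
have mU : measurable U.
  rewrite (_ : U = ~` [set s | (psum s 1 <= 0)%R]).
    by apply: measurableC; exact: measurable_psum_le0.
  by apply/seteqP; split=> s; rewrite /U/= ltNge;
    [move=> /negP|move=> h; apply/negP].
have -> : return_prob Pi = Pi (\bigcup_n first_return n).
  apply/esym/measure_partition => //.
  - exact: measurable_first_return.
  - by move=> s [n _ ?]; exists n.
  - by move=> n s ?; exists n.
  - move=> s k k' [k0 [sk0 sneg]] [k0' [sk0' sneg']].
    have [kk'|kk'|//] := ltngtP k k'.
      by have := sneg' k; rewrite k0 kk' sk0 ltxx => /(_ isT).
    by have := sneg k'; rewrite k0' kk' sk0' ltxx => /(_ isT).
have mV : measurable (\bigcup_n first_return n : set (path_space R)).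
  by apply: bigcupT_measurable => n; exact: measurable_first_return.
apply: (@le_lt_trans _ _ (Pi (~` U))).
  apply: le_measure; rewrite ?inE//; first exact: measurableC.
  move=> s [n _ [n0 [sn0 sneg]]]; rewrite /U /= => s1.
  case: n n0 sn0 sneg => [//|[|n]] _ sn0 sneg.
    by rewrite sn0 ltxx in s1.
  by have := lt_trans s1 (sneg 1%N isT); rewrite ltxx.
by rewrite probability_setC// lteBlDl// ?fin_num_measure// lteDr// fin_num_measure.
Qed.

(** [beta] is the return probability. The first series is geometric in it; in the second, exchanging
    the sums over lengths and over returns leaves the logarithmic series. *)
Lemma sum_return_zeros :
  exists2 beta : R, (0 <= beta < 1)%R &
    \sum_(0 <= n <oo) Pi (loop_le0 n) = ((1 - beta)^-1)%:E /\
    \sum_(0 <= n <oo) (n.+1%:R^-1)%:E * Pi [set s | psum s n.+1 = 0%R] =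
      (- ln (1 - beta))%:E.
Proof.
have b0 : 0 <= return_prob Pi by exact: nneseries_ge0.
have bfin : return_prob Pi \is a fin_num.
  by rewrite ge0_fin_numE// (lt_trans return_prob_lt1)// ltry.
pose beta := fine (return_prob Pi).
have bE : return_prob Pi = beta%:E by rewrite fineK.
have b01 : (0 <= beta < 1)%R.
  by rewrite -lee_fin -lte_fin -bE b0 return_prob_lt1.
have powE r : return_pow Pi r = (beta ^+ r)%:E.
  by elim: r => //= r ->; rewrite bE exprS EFinM.
exists beta => //; split.
  rewrite sum_prob_loop_le0//; under eq_eseriesr do rewrite powE.
  exact: geometric_nneseries.
rewrite -log_series//.
under eq_eseriesr do rewrite prob_return_zeros//.
rewrite nneseries_interchange; last first.
  by move=> i j; rewrite mule_ge0// lee_fin invr_ge0 ler0n.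
apply: eq_eseriesr => r _.
rewrite nneseriesZl// EFinM; congr (_ * _).
(* The two series differ by the term of length [0], which vanishes since a loop of length [0] has no
   return. *)
rewrite -powE -sum_prob_loop_zeros// [RHS]nneseries_recl//.
rewrite loop_zerosS0 measure0 add0e -(@nneseries_addn _ _ 1)//.
by apply: eq_eseriesr => n _; rewrite addn1.
Qed.

End loop_mass.

(** * Ladder times and renewal measures *)

Section ladder_times.
Context {R : realType} (r : rel R).
Hypothesis r_trans : transitive r.
Hypothesis r_negtrans : forall a b c, r a b -> ~~ r c b -> r a c.
Implicit Type s : nat -> R.

(** Let [m] be the preceding ladder time. Times before [m] are handled by induction and
    transitivity; a time strictly between [m] and [k] does not beat [m], whereas [k] does, so
    [r_negtrans] applies. *)
Lemma ladder_time_record s n k : ladder_time r s n = Some k ->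
  forall j, (j < k)%N -> r (s k) (s j).
Proof.
elim: n k => [k [<-]//|n IH k] /=.
case E : (ladder_time r s n) => [m|//] /= /next_ladderE[mk rkm nr] j jk.
have [jm|mj|->//] := ltngtP j m; first exact: r_trans rkm (IH _ E _ jm).
by apply: r_negtrans rkm (nr _ _); rewrite mj.
Qed.

Lemma ladder_time_lt s n n' k k' : (n < n')%N ->
  ladder_time r s n = Some k -> ladder_time r s n' = Some k' -> (k < k')%N.
Proof.
elim: n' k' => // n' IH k'; rewrite ltnS leq_eqVlt => /predU1P[->|nn'] nk /=.
  by rewrite nk /= => /next_ladderE[].
case E : (ladder_time r s n') => [m|//] /= /next_ladderE[mk _ _].
exact: ltn_trans (IH _ nn' nk E) mk.
Qed.

(** Induction on the distance from a ladder time [m] to [k]: since [k] beats [m], the next ladder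
    time exists, and by minimality it does not overshoot [k]. *)
Lemma record_ladder_time s k : (forall j, (j < k)%N -> r (s k) (s j)) ->
  exists n, ladder_time r s n = Some k.
Proof.
suff H N : forall n m, ladder_time r s n = Some m -> (m <= k)%N ->
    (k - m <= N)%N -> (forall j, (j < k)%N -> r (s k) (s j)) ->
    exists n, ladder_time r s n = Some k.
  by apply: (H k 0%N 0%N) => //; rewrite subn0.
elim: N => [|N IH] n m nm mk kmN rk.
  by exists n; rewrite nm; congr Some; lia.
have [<-|mk'] := eqVneq m k; first by exists n.
have ltmk : (m < k)%N by rewrite ltn_neqAle mk'.
case E : (next_ladder r s m) => [k'|].
  have [mk1 rk1 nr] := (next_ladderE _ _ _ _).1 E.
  apply: (IH n.+1 k') => //=; rewrite ?nm//; last by lia.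
  rewrite leqNgt; apply/negP => kk'.
  by have := nr k; rewrite ltmk kk' rk// => /(_ isT).
move: E; rewrite /next_ladder; case: pselect => // nex _.
by case: nex; exists k; rewrite ltmk rk.
Qed.

End ladder_times.

Section renewal_series.
Context d {T : measurableType d} {R : realType} (P : probability T R).
Variable X : nat -> {RV P >-> R}.
Variable r : rel R.
Hypothesis r_trans : transitive r.
Hypothesis r_negtrans : forall a b c, r a b -> ~~ r c b -> r a c.
Hypothesis mr : forall k m, measurable [set w | r (walk X k w) (walk X m w)].

(** Ladder times are exactly the record times, each with a unique rank [n]. Summing over [n] first
    leaves the event of a record at the deterministic time [k], so no Markov property at random
    times is involved. *)
Lemma renewal_series (A : set R) : measurable A ->
  \sum_(0 <= n <oo) P (value_event (fun w => ladder_height r (walk X ^~ w) n) A) =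
  \sum_(0 <= k <oo) P ([set w | forall j, (j < k)%N ->
    r (walk X k w) (walk X j w)] `&` [set w | A (walk X k w)]).
Proof.
move=> mA.
have mL n k : measurable ([set w | ladder_time r (walk X ^~ w) n = Some k] `&`
    [set w | A (walk X k w)]).
  apply: measurableI; first exact: measurable_ladder_time.
  by rewrite -[X in measurable X]setTI; exact: measurable_walk.
transitivity (\sum_(0 <= n <oo) \sum_(0 <= k <oo)
    P ([set w | ladder_time r (walk X ^~ w) n = Some k] `&`
       [set w | A (walk X k w)])).
  apply: eq_eseriesr => n _; apply: measure_partition => // [w|k w|w k k'].
  - rewrite /value_event/= /ladder_height => -[h].
    by case E : ladder_time => [k|//] [<-] Ah; exists k.
  - by move=> [/= E Aw]; exists (walk X k w); rewrite // /ladder_height E.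
  - by move=> [/= -> _] [/= [->]].
rewrite nneseries_interchange//; apply: eq_eseriesr => k _; apply: esym.
apply: measure_partition => // [w|n w|w n n'].
- by move=> [/= /record_ladder_time[n En] Aw]; exists n.
- by move=> [/= E Aw]; split=> //=; exact: (ladder_time_record r_trans r_negtrans E).
- move=> [/= E _] [/= E' _]; have [nn'|nn'|//] := ltngtP n n'.
    by have := ladder_time_lt nn' E E'; rewrite ltnn.
  by have := ladder_time_lt nn' E' E; rewrite ltnn.
Qed.

End renewal_series.

(** * Integration against series of finite measures *)

Section raw_integral.
Context d (T : measurableType d) (R : realType).
Import HBNNSimple.

(* [m1] and [m2] are bare set functions: [desc_renewal X \x asc_renewal X]
   carries no measure structure as long as [asc_renewal X] is not known to be
   sigma-finite. *)
Lemma eq_raw_integral (m1 m2 : set T -> \bar R) (D : set T) (f : T -> \bar R) :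
  (forall A, measurable A -> m1 A = m2 A) ->
  \int[m1]_(x in D) f x = \int[m2]_(x in D) f x.
Proof.
move=> m12; have sE (h : {nnsfun T >-> R}) : sintegral m1 h = sintegral m2 h.
  by apply: eq_fsbigr => x _; rewrite m12.
have nnE (g : T -> \bar R) :
    [set sintegral m1 h | h in
      [set h : {nnsfun T >-> R} | forall x, (h x)%:E <= g x]] =
    [set sintegral m2 h | h in
      [set h : {nnsfun T >-> R} | forall x, (h x)%:E <= g x]].
  by apply/seteqP; split=> _ [h hg <-]; exists h.
by rewrite /integral !nnE.
Qed.

Lemma raw_integral_mkcond (m : set T -> \bar R) (D : set T) (f g : T -> \bar R) :
  f \_ D = g -> \int[m]_(x in D) f x = \int[m]_x g x.
Proof. by move=> <-; rewrite /integral patch_setT. Qed.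

End raw_integral.

Section product_of_series.
Context d1 d2 (T1 : measurableType d1) (T2 : measurableType d2) (R : realType).
Variables (mu : nat -> {finite_measure set T1 -> \bar R})
  (nu : nat -> {finite_measure set T2 -> \bar R}).
Variables (m1 : set T1 -> \bar R) (m2 : set T2 -> \bar R).
Hypothesis m1E : forall A, measurable A -> m1 A = \sum_(0 <= i <oo) mu i A.
Hypothesis m2E : forall A, measurable A -> m2 A = \sum_(0 <= j <oo) nu j A.

Let mu_nu i j : {measure set (T1 * T2) -> \bar R} := mu i \x nu j.
Let prod_row i : {measure set (T1 * T2) -> \bar R} := mseries (mu_nu i) 0.

(** Expanding both factors, the product set function agrees on measurable sets with the double
    series of the products of finite measures; Tonelli then applies to each term. *)
Lemma ge0_integral_product_series (h : T1 * T2 -> \bar R) :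
  measurable_fun setT h -> (forall p, 0 <= h p) ->
  \int[m1 \x m2]_p h p =
  \sum_(0 <= i <oo) \sum_(0 <= j <oo) \int[mu i]_y \int[nu j]_z h (y, z).
Proof.
move=> mh h0.
transitivity (\int[mseries prod_row 0]_p h p).
  apply: eq_raw_integral => A mA; rewrite /product_measure1.
  rewrite (@eq_raw_integral _ _ _ m1 (mseries mu 0)); last first.
    by move=> B mB; rewrite m1E.
  rewrite ge0_integral_measure_series//.
  - rewrite /mseries; apply: eq_eseriesr => i _ /=.
    rewrite (eq_integral (fun x => \sum_(0 <= j <oo) nu j (xsection A x))).
      rewrite integral_nneseries// => j; exact: measurable_fun_xsection.
    by move=> x _; rewrite /= m2E//; exact: measurable_xsection.
  - move=> x _ /=; rewrite m2E; first exact: nneseries_ge0.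
    exact: measurable_xsection.
  - rewrite (_ : _ \o _ = fun x => \sum_(0 <= j <oo) nu j (xsection A x)).
      apply: ge0_emeasurable_sum => // j _; exact: measurable_fun_xsection.
    by apply/funext => x /=; rewrite m2E//; exact: measurable_xsection.
rewrite ge0_integral_measure_series//; apply: eq_eseriesr => i _.
rewrite ge0_integral_measure_series//; apply: eq_eseriesr => j _.
exact: fubini_tonelli1.
Qed.

End product_of_series.

Section law_on_event.
Context d {T : measurableType d} {d'} {T' : measurableType d'} {R : realType}.
Variables (P : probability T R) (E : set T) (mE : measurable E)
  (g : {mfun T >-> T'}).

(** The unnormalized law of [g] on the event [E]; the renewal measures are series of such laws. The
    measurability proof is an argument so that the measure structure can be inferred. *)
Definition law_on of measurable E := fun A => P (g @^-1` A `&` E).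

Let law_on0 : law_on mE set0 = 0.
Proof. by rewrite /law_on preimage_set0 set0I measure0. Qed.

Let law_on_ge0 A : 0 <= law_on mE A. Proof. exact: measure_ge0. Qed.

Let law_on_sigma_additive : semi_sigma_additive (law_on mE).
Proof.
rewrite -[law_on mE]/(pushforward (mrestr P mE) g).
exact: measure_semi_sigma_additive.
Qed.

HB.instance Definition _ := isMeasure.Build _ _ _ (law_on mE)
  law_on0 law_on_ge0 law_on_sigma_additive.

Let law_on_fin : fin_num_fun (law_on mE).
Proof.
move=> A mA; apply: fin_num_measure; apply: measurableI => //.
by rewrite -[X in measurable X]setTI; exact: measurable_funP.
Qed.

HB.instance Definition _ := @Measure_isFinite.Build _ _ _ (law_on mE) law_on_fin.

Lemma ge0_integral_law_on (h : T' -> \bar R) :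
  measurable_fun setT h -> (forall y, 0 <= h y) ->
  \int[law_on mE]_y h y = \int[P]_(w in E) h (g w).
Proof.
move=> mh h0.
transitivity (\int[pushforward (mrestr P mE) g]_y h y).
  exact: eq_raw_integral.
rewrite ge0_integral_pushforward// preimage_setT -(setUv E).
have mhg D : measurable_fun D (h \o g).
  by apply: measurable_funTS; exact: measurableT_comp.
have mEC := measurableC mE.
rewrite ge0_integral_setU//; last 2 first.
- by move=> w _; exact: h0.
- by apply/disj_setPS; rewrite setICr.
(* The restricted measure does not charge the complement of [E]. *)
rewrite [X in _ + X](eq_measure_integral mzero); last first.
  move=> A mA AE; rewrite /= /mrestr/= (_ : A `&` E = set0) ?measure0//.
  by apply/seteqP; split=> // w [/AE].
rewrite integral_measure_zero adde0; apply: eq_measure_integral => A mA AE.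
by rewrite /= /mrestr (setIidl AE).
Qed.

End law_on_event.

(** * The factorization of the Green operators *)

Section green_path.
Context {R : realType} (Pi : probability (path_space R) R).
Hypothesis Pi_iid : iid_law Pi.
Implicit Types (F : R -> \bar R) (D : set R).

Lemma measurable_fun_partial_integral (E : set (path_space R))
    (G : path_space R * path_space R -> \bar R) :
  measurable E -> measurable_fun setT G -> (forall p, 0 <= G p) ->
  measurable_fun setT (fun s => \int[Pi]_(t in E) G (s, t)).
Proof.
move=> mE mG G0.
rewrite (_ : (fun _ => _) = fubini_F Pi (G \_ (setT `*` E))).
  apply: measurable_fun_fubini_tonelli_F.
    apply/(measurable_restrictT _ (measurableX measurableT mE)).
    exact: measurable_funTS.
  by move=> p; exact: erestrict_ge0.
apply/funext => s; rewrite /fubini_F [LHS]integral_mkcond.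
by apply: eq_integral => t _; rewrite !patchE in_setX/= in_setT.
Qed.

Definition ladder_integral D F m k : \bar R :=
  \int[Pi]_(s in desc_record m `&` [set s | D (- psum s m)%R])
    \int[Pi]_(t in asc_record k) F (psum s m + psum t k)%R.

Lemma measurable_fun_psum_pair F m k : measurable_fun setT F ->
  measurable_fun setT (fun p : path_space R * path_space R =>
    F (psum p.1 m + psum p.2 k)%R).
Proof.
move=> mF; apply: measurableT_comp => //; apply: measurable_funD.
  exact: (measurableT_comp (@measurable_psum R m) measurable_fst).
exact: (measurableT_comp (@measurable_psum R k) measurable_snd).
Qed.

(** The cuts at the first minimum and, after reversal, at the first maximum express the left side by
    three independent pieces of path. Two diagonal summations free their lengths, and the sum over
    loop lengths factors out. *)
Lemma green_path D F :
  measurable D -> (forall u v, (u <= v)%R -> D v -> D u) ->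
  measurable_fun setT F -> (forall u, 0 <= F u) ->
  \sum_(0 <= n <oo)
    \int[Pi]_(s in [set s | forall k, (k <= n)%N -> D (- psum s k)%R])
      F (psum s n) =
  (\sum_(0 <= n <oo) Pi (loop_le0 n)) *
  \sum_(0 <= m <oo) \sum_(0 <= k <oo) ladder_integral D F m k.
Proof.
move=> mD Ddown mF F0.
have mFs s m : measurable_fun setT (fun u => F (psum s m + u)%R).
  by apply: measurableT_comp => //; exact: measurable_funD.
have mE m : measurable (desc_record m `&`
    [set s : path_space R | D (- psum s m)%R]).
  by apply: measurableI; [exact: measurable_desc_record|exact: measurable_psum_opp].
have loop0 : 0 <= \sum_(0 <= n <oo) Pi (loop_le0 n) by exact: nneseries_ge0.
have lad0 m k : 0 <= ladder_integral D F m k.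
  by apply: integral_ge0 => s _; exact: integral_ge0.
rewrite (eq_eseriesr (fun n _ =>
  @integral_split_argmin _ _ Pi_iid D F n mD Ddown mF F0)).
rewrite (nneseries_diagonal (a := fun m l =>
  \int[Pi]_(s in desc_record m `&` [set s | D (- psum s m)%R])
      \int[Pi]_(t in stay_ge0 l) F (psum s m + psum t l)%R)); last first.
  by move=> m l; apply: integral_ge0 => s _; exact: integral_ge0.
rewrite -nneseriesZle//; last by move=> m; exact: nneseries_ge0.
apply: eq_eseriesr => m _.
transitivity (\sum_(0 <= l <oo) \sum_(0 <= k <oo)
    if (k <= l)%N then ladder_integral D F m k * Pi (loop_le0 (l - k)) else 0).
  apply: eq_eseriesr => l _.
  under eq_integral => s _ do rewrite
    (integral_reversal Pi_iid l (mFs s m))//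
    (integral_split_argmax Pi_iid l (mFs s m))//.
  have mU k : measurable_fun setT (fun s =>
      \int[Pi]_(t in asc_record k) F (psum s m + psum t k)%R).
    apply: (@measurable_fun_partial_integral _
      (fun p => F (psum p.1 m + psum p.2 k)%R)) => //.
      exact: measurable_asc_record.
    exact: measurable_fun_psum_pair.
  have U0 k s : 0 <= \int[Pi]_(t in asc_record k) F (psum s m + psum t k)%R.
    exact: integral_ge0.
  rewrite integral_nneseries//; last 2 first.
  - move=> k; case: (k <= l)%N; last exact: measurable_cst.
    apply: measurable_funTS; apply: emeasurable_funM => //; exact: measurable_cst.
  - by move=> k s _; case: ifP => // _; apply: mule_ge0.
  apply: eq_eseriesr => k _; case: ifP => _; last exact: integral0.
  by rewrite ge0_integralZr//; exact: measurable_funTS.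
rewrite (nneseries_diagonal
  (a := fun k l => ladder_integral D F m k * Pi (loop_le0 l))); last first.
  by move=> k l; exact: mule_ge0.
rewrite -nneseriesZle//; apply: eq_eseriesr => k _.
by rewrite nneseriesZle// muleC.
Qed.

Definition psum_at n (s : path_space R) := psum s n.

Definition psumN_at n (s : path_space R) := (- psum s n)%R.

Lemma measurable_psumN_at n : measurable_fun setT (psumN_at n).
Proof. by apply: measurable_funN; exact: measurable_psum. Qed.

HB.instance Definition _ n :=
  @isMeasurableFun.Build _ _ (path_space R) R (psum_at n) (@measurable_psum R n).

HB.instance Definition _ n :=
  @isMeasurableFun.Build _ _ (path_space R) R (psumN_at n) (measurable_psumN_at n).

(** On a descending record [- psum s m] is nonnegative, on an ascending one [psum t k] is; hence the
    restriction to [[0, +oo[] in both variables loses nothing. *)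
Lemma ladder_integral_product (m1 m2 : set R -> \bar R) D F :
  (forall A, measurable A -> m1 A = \sum_(0 <= m <oo)
     Pi (desc_record m `&` [set s | A (- psum s m)%R])) ->
  (forall A, measurable A -> m2 A = \sum_(0 <= k <oo)
     Pi (asc_record k `&` [set s | A (psum s k)])) ->
  measurable D -> measurable_fun setT F -> (forall u, 0 <= F u) ->
  \int[m1 \x m2]_p ((fun p => F (- p.1 + p.2)%R) \_
    ((D `&` `[0%R, +oo[) `*` `[0%R, +oo[)) p =
  \sum_(0 <= m <oo) \sum_(0 <= k <oo) ladder_integral D F m k.
Proof.
move=> m1E m2E mD mF F0.
pose mu m : {finite_measure set R -> \bar R} :=
  law_on Pi (psumN_at m) (measurable_desc_record m).
pose nu k : {finite_measure set R -> \bar R} :=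
  law_on Pi (psum_at k) (measurable_asc_record k).
have mD' : measurable (D `&` `[0%R, +oo[) by exact: measurableI.
pose H := (fun p : R * R => F (- p.1 + p.2)%R) \_
  ((D `&` `[0%R, +oo[) `*` `[0%R, +oo[).
have mH : measurable_fun setT H.
  apply/(measurable_restrictT _ (measurableX mD' (measurable_itv _))).
  apply: measurable_funTS; apply: measurableT_comp => //.
  apply: measurable_funD => //.
  exact: (measurable_funN (@measurable_fst _ _ R R)).
have H0 p : 0 <= H p by exact: erestrict_ge0.
rewrite (@ge0_integral_product_series _ _ R R R mu nu)//; last 2 first.
- by move=> A mA; rewrite m1E//; apply: eq_eseriesr => m _; rewrite setIC.
- by move=> A mA; rewrite m2E//; apply: eq_eseriesr => m _; rewrite setIC.
apply: eq_eseriesr => m _; apply: eq_eseriesr => k _.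
rewrite ge0_integral_law_on//; last 2 first.
- exact: (measurable_fun_fubini_tonelli_F H mH H0).
- by move=> y; exact: integral_ge0.
rewrite /ladder_integral integral_mkcondr; apply: eq_integral => s /set_mem sm.
rewrite ge0_integral_law_on//; last first.
  by apply: (measurableT_comp mH); exact: pair1_measurable.
have sm_le0 : (psum s m <= 0)%R.
  by have [->|/sm/ltW] := posnP m; rewrite psum0.
rewrite patchE; case: ifPn => [/set_mem/= Ds|/negP Ds].
  apply: eq_integral => t /set_mem tk; rewrite /H patchE mem_set/= ?opprK//.
  have tk_ge0 : (0 <= psum t k)%R.
    by have [->|/tk/ltW] := posnP k; rewrite psum0.
  by split; [split => //; rewrite /= in_itv/= oppr_ge0 sm_le0|
    rewrite in_itv/= tk_ge0].
apply: integral0_eq => t _; rewrite /H patchE memNset//= => -[[Ds' _] _].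
by apply: Ds; exact: mem_set.
Qed.

End green_path.

(** * From the random walk to the law of its path of increments *)

Section random_walk_path.
Context d {T : measurableType d} {R : realType} (P : probability T R).
Variable X : nat -> {RV P >-> R}.

Definition path_of (w : T) : path_space R := fun i => X i w.

Lemma measurable_path_of : measurable_fun setT path_of.
Proof. by apply: measurable_fun_path => i; exact: measurable_funP. Qed.

HB.instance Definition _ :=
  @isMeasurableFun.Build _ _ T (path_space R) path_of measurable_path_of.

Definition path_law : probability (path_space R) R := distribution P path_of.

Lemma path_lawE (E : set (path_space R)) :
  path_law E = P [set w | E (path_of w)].
Proof. by []. Qed.

Lemma ge0_integral_path_law (E : set (path_space R))
    (Phi : path_space R -> \bar R) : measurable E ->
  measurable_fun setT Phi -> (forall s, 0 <= Phi s) ->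
  \int[path_law]_(s in E) Phi s =
  \int[P]_(w in [set w | E (path_of w)]) Phi (path_of w).
Proof.
move=> mE mPhi Phi0; rewrite /path_law ge0_integral_pushforward//.
exact: measurable_funTS.
Qed.

Lemma iid_law_path : iid X -> iid_law path_law.
Proof.
move=> [Xind Xid]; exists (distribution P (X 0%N)) => sigma tau st n A mA.
rewrite path_lawE.
(* The indices [sigma i] are distinct, so independence applies to them; [tau] recovers from an index
   the set imposed on it. *)
rewrite (_ : [set w | _] = \bigcap_(j in [set` map sigma (iota 0 n)])
    (X j @^-1` A (tau j))); last first.
  apply/seteqP; split=> w /=.
    move=> h j /mapP[i]; rewrite mem_iota add0n => /andP[_ ilt] -> /=.
    by rewrite st; exact: h.
  move=> h i ilt; have := h (sigma i); rewrite /= st; apply.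
  by apply: map_f; rewrite mem_iota.
rewrite Xind//; last by rewrite map_inj_uniq ?iota_uniq//; exact: can_inj st.
rewrite big_map -[n in iota 0 n]subn0 -/(index_iota 0 n) big_mkord.
by apply: eq_bigr => i _; rewrite st; exact: Xid.
Qed.

(** Without upward steps almost every path would stay at or below [0], against the limsup being
    [+oo]. *)
Lemma oscillating_up_step : iid X -> oscillating X ->
  0 < path_law [set s | (0 < psum s 1)%R].
Proof.
move=> [_ Xid] Xosc; rewrite lt0e measure_ge0 andbT; apply/eqP => up0.
have Ni i : P.-negligible (X i @^-1` `]0%R, +oo[).
  apply/negligibleP.
    by rewrite -[X in measurable X]setTI; exact: measurable_funP.
  have /= := Xid i `]0%R, +oo[%classic (measurable_itv _).
  rewrite /distribution /pushforward => ->; rewrite -up0 path_lawE.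
  congr (P _); apply/seteqP; split=> w /=; rewrite in_itv/= andbT;
    by rewrite psumS psum0 add0r.
have N := negligibleU Xosc (negligible_bigcup Ni).
have : P setT = 0.
  apply: measure_negligible => //; apply: negligibleS N => w _ /=.
  have [up|noup] := pselect ((\bigcup_k (X k @^-1` `]0%R, +oo[)) w).
    by right.
  left => -[sup _].
  have Xle0 i : (X i w <= 0)%R.
    rewrite leNgt; apply/negP => Xi; apply: noup; exists i => //=.
    by rewrite in_itv/= Xi.
  suff : limn_esup (fun n => (walk X n w)%:E) <= 0 by rewrite sup.
  rewrite limn_esup_lim; apply: lime_le; first exact: is_cvg_esups.
  apply: nearW => n; apply: ge_ereal_sup => _ [k _ <-].
  by rewrite lee_fin; apply: sumr_le0.
by rewrite probability_setT => /eqP; rewrite onee_eq0.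
Qed.

Lemma desc_renewalE (A : set R) : measurable A -> desc_renewal X A =
  \sum_(0 <= m <oo) path_law (desc_record m `&` [set s | A (- psum s m)%R]).
Proof.
move=> mA; pose r (u v : R) := (u < v)%R.
have mr k m : measurable [set w | r (walk X k w) (walk X m w)].
  by have := measurable_path_of measurableT (measurable_psum_lt k m); rewrite setTI.
have mA' : measurable (Num.norm @^-1` A : set R).
  by rewrite -[X in measurable X]setTI; exact: (@normr_measurable R setT).
transitivity (\sum_(0 <= n <oo) P (value_event (fun w =>
    ladder_height r (walk X ^~ w) n) (Num.norm @^-1` A))).
  apply: eq_eseriesr => n _; congr (P _).
  apply/seteqP; split=> w; rewrite /value_event /=.
    by rewrite /desc_height; case: ladder_height => [h|] [h'] //= [<-] Ah; exists h.
  by rewrite /desc_height => -[h -> Ah]; exists `|h|%R.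
rewrite renewal_series//; last 2 first.
- by move=> y x z; exact: lt_trans.
- by move=> a b c ab; rewrite /r -leNgt; exact: lt_le_trans.
apply: eq_eseriesr => m _; rewrite path_lawE; congr (P _).
(* Descending records are nonpositive, so the absolute value of the height is its opposite. *)
have E w : desc_record m (path_of w) ->
    `|psum (path_of w) m|%R = (- psum (path_of w) m)%R.
  by move=> wm; rewrite ler0_norm//; have [->|/wm/ltW] := posnP m; rewrite psum0.
apply/seteqP; split=> w [/= wm Aw]; split => //.
  by have := Aw; rewrite -[walk X m w]/(psum (path_of w) m) E.
by rewrite -[walk X m w]/(psum (path_of w) m) E.
Qed.

Lemma asc_renewalE (A : set R) : measurable A -> asc_renewal X A =
  \sum_(0 <= m <oo) path_law (asc_record m `&` [set s | A (psum s m)]).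
Proof.
move=> mA; rewrite /asc_renewal /asc_height renewal_series//.
- by move=> y x z xy yz; exact: lt_trans yz xy.
- by move=> a b c ab; rewrite -leNgt => /le_lt_trans; exact.
- move=> k m.
  by have := measurable_path_of measurableT (measurable_psum_lt m k); rewrite setTI.
Qed.

(** Both quantities equal [1 / (1 - b)], the left one as [exp (- ln (1 - b))]; this also gives
    positivity and finiteness. *)
Lemma c_eq_loop : iid X -> oscillating X ->
  c_eq X = \sum_(0 <= n <oo) path_law (loop_le0 n) /\ 0 < c_eq X < +oo.
Proof.
move=> Xiid Xosc.
have [b /andP[b0 b1] [loopE logE]] :=
  sum_return_zeros (iid_law_path Xiid) (oscillating_up_step Xiid Xosc).
have b1' : (0 < 1 - b)%R by rewrite subr_gt0.
have -> : c_eq X = ((1 - b)^-1)%:E.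
  rewrite /c_eq -(@nneseries_addn _ _ 1); last first.
    by move=> i; rewrite mule_ge0// lee_fin invr_ge0.
  under eq_eseriesr do rewrite addn1.
  transitivity (expeR (- ln (1 - b))%:E); first by rewrite -logE.
  by rewrite /= expRN lnK.
by rewrite loopE lte_fin invr_gt0 b1' ltry.
Qed.

(** Both Green operators at once: [D] will be []-oo, x]] for the weak constraint and []-oo, x[] for
    the strict one. *)
Lemma green_factorization (D : set R) (f : R -> R) (x : R) :
  iid X -> oscillating X ->
  measurable_fun (`[0%R, +oo[ : set R) f ->
  (forall y : R, (0 <= y)%R -> (0 <= f y)%R) ->
  measurable D -> (forall u v, (u <= v)%R -> D v -> D u) -> D 0%R ->
  (forall u, D u -> (u <= x)%R) ->
  \sum_(0 <= n <oo) 'E_P[fun w => (f (x + walk X n w) *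
    \1_[set w | forall k, (1 <= k <= n)%N -> D (- walk X k w)] w)%R] =
  c_eq X * \int[desc_renewal X \x asc_renewal X]_(p in
    (D `&` `[0%R, +oo[) `*` `[0%R, +oo[) (f (x - p.1 + p.2)%R)%:E.
Proof.
move=> Xiid Xosc mf f0 mD Ddown D0 Dx.
(* [f] is controlled on [[0, +oo[] only. Extended by [0] it is measurable and nonnegative
   everywhere, and it is unchanged wherever the walk or the integral evaluates it. *)
pose F (u : R) := (f \_ `[0%R, +oo[ (x + u)%R)%:E.
have FE u : (0 <= x + u)%R -> F u = (f (x + u))%:E.
  by move=> xu; rewrite /F patchE mem_set//= in_itv/= xu.
have F0 u : 0 <= F u.
  rewrite lee_fin patchE; case: ifPn => // /set_mem/=.
  by rewrite in_itv/= andbT => /f0.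
have mF : measurable_fun setT F.
  apply/measurable_EFinP; apply: (measurableT_comp (f := f \_ `[0%R, +oo[)).
    exact/(measurable_restrictT _ (measurable_itv _)).
  exact: measurable_funD.
rewrite (raw_integral_mkcond _ (g := (fun p => F (- p.1 + p.2)%R) \_
    ((D `&` `[0%R, +oo[) `*` `[0%R, +oo[))); last first.
  apply/funext => -[y z]; rewrite !patchE; case: ifPn => // /set_mem/=.
  rewrite !in_itv/= !andbT => -[[/Dx yx y0] z0].
  by rewrite FE ?addrA//=; lra.
rewrite (ladder_integral_product desc_renewalE asc_renewalE)//.
have [-> _] := c_eq_loop Xiid Xosc.
rewrite -(green_path (iid_law_path Xiid))//; apply: eq_eseriesr => n _.
pose E := [set s : path_space R | forall k, (k <= n)%N -> D (- psum s k)%R].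
have mE : measurable E.
  by apply: measurable_forall_nat => k; exact: measurable_psum_opp.
rewrite ge0_integral_path_law//; last exact: measurable_comp_psum.
rewrite unlock [RHS]integral_mkcond; apply: eq_integral => w _.
(* The constraint at time [0], present only in [E], is [D 0]. *)
have EE : [set w | forall k, (1 <= k <= n)%N -> D (- walk X k w)%R] w <->
    [set w | E (path_of w)] w.
  split=> /= h k; last by move=> /andP[_ kn]; exact: h.
  by case: k => [|k] kn; [rewrite psum0 oppr0|exact: h].
rewrite patchE indicE; case: ifPn => [/set_mem Ew|/negP Ew].
  rewrite mem_set; last exact/EE.
  rewrite mulr1 FE//; have := Dx _ (Ew n (leqnn n)).
  by rewrite -lerBlDl sub0r lerNl.
rewrite memNset ?mulr0// => /EE Ew'; exact/Ew/mem_set.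
Qed.

End random_walk_path.

Theorem theoremA3 (R : realType) (d : measure_display) (T : measurableType d)
    (P : probability T R) (X : nat -> {RV P >-> R})
    (X_iid : iid X) (X_osc : oscillating X) :
  0 < c_eq X < +oo /\
  forall f : R -> R,
    measurable_fun (`[0%R, +oo[ : set R) f ->
    (forall y : R, (0 <= y)%R -> (0 <= f y)%R) ->
    (forall x : R, (0 <= x)%R ->
      green X f x = c_eq X *
        \int[desc_renewal X \x asc_renewal X]_(p in `[0%R, x] `*` `[0%R, +oo[)
          (f (x - p.1 + p.2)%R)%:E) /\
    (forall x : R, (0 < x)%R ->
      green_bar X f x = c_eq X *
        \int[desc_renewal X \x asc_renewal X]_(p in `[0%R, x[ `*` `[0%R, +oo[)
          (f (x - p.1 + p.2)%R)%:E).
Proof.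
split; first by have [] := c_eq_loop X_iid X_osc.
move=> f mf f0; split=> x x0.
(* The domain is written as a set closed downwards, which encodes the constraint on the walk, cut
   with the half-line that carries the renewal measure. *)
- rewrite (_ : `[0%R, x]%classic = [set` `]-oo, x]] `&` `[0%R, +oo[); last first.
    by apply/seteqP; split=> y /=; rewrite !in_itv/= andbT;
      [move/andP=> []|move=> [-> ->]].
  rewrite -green_factorization//=.
  + apply: eq_eseriesr => n _; congr ('E_P[_]); apply/funext => w.
    congr (_ * \1_ _ _)%R; apply/seteqP; split=> v /= h k kn; have := h k kn;
      by rewrite in_itv/=; lra.
  + by move=> u v uv /=; rewrite !in_itv/=; exact: le_trans.
- rewrite (_ : `[0%R, x[%classic = [set` `]-oo, x[] `&` `[0%R, +oo[); last first.
    by apply/seteqP; split=> y /=; rewrite !in_itv/= andbT;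
      [move/andP=> []|move=> [-> ->]].
  rewrite -green_factorization//=.
  + apply: eq_eseriesr => n _; congr ('E_P[_]); apply/funext => w.
    congr (_ * \1_ _ _)%R; apply/seteqP; split=> v /= h k kn; have := h k kn;
      by rewrite in_itv/=; lra.
  + by move=> u v uv /=; rewrite !in_itv/=; exact: le_lt_trans.
  + by move=> u /=; rewrite in_itv/=; exact: ltW.
Qed.
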